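(* Let $\Lambda\in M$ be a solution of the McKean--Vlasov equation (stated in the context) with initial data $X_{0-}$ such that $\mathbb{E}|X_{0-}|<\infty$. Let $(\Lambda^n)_{n\ge 1}$ be a sequence of physical solutions to the McKean--Vlasov equation, with corresponding initial conditions $(X_{0-}^n)_{n\ge 1}$, all of which have finite expectation. Suppose that $X_{0-}^n\to X_{0-}$ weakly (in law) and $\Lambda^n\to \Lambda$ in $(D([-1,\infty)),\mathrm{M1})$. Then $\Lambda$ satisfies the physical jump condition $$\Lambda_{t}-\Lambda_{t-}=\inf\{x>0:\alpha\,\mathbb{P}(\tau\ge t,\ X_{t-}\in(0,x])<x\}$$ at all $t\ge 0$, where $X_t=X_{0-}+B_t-\Lambda_t$ and $\tau=\inf\{t\ge 0: X_t\le 0\}$.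
   Context: Fix $\alpha>0$. For an interval $I$, $D(I)$ is the space of càdlàg functions $I\to\mathbb{R}$. Elements $f$ of $D([0,\infty))$ carry a prescribed value $f_{0-}=f(0-)$, so a jump at time $0$ is allowed. Let $$M=\{\ell\in D([0,\infty)):\ \ell_{0-}=0,\ \ell\text{ is increasing (non-decreasing)}\}.$$ McKean--Vlasov equation: given an initial condition $X_{0-}$ (a real random variable) and a Brownian motion $B$ (started at $0$) independent of $X_{0-}$, a solution with initial data $X_{0-}$ is a function $\Lambda\in M$ such that $$X_t=X_{0-}+B_t-\Lambda_t\ (t\ge0),\qquad \tau=\inf\{t\ge0:X_t\le0\},\qquad \Lambda_t=\alpha\,\mathbb{P}(\tau\le t)\ (t\ge 0).$$ The solution depends only on the law of $X_{0-}$. At $t=0$, $X_{t-}$ means the initial condition $X_{0-}$ and $\Lambda_{0-}=0$. A solution $\Lambda\in M$ is called physical if $\Lambda_{t}-\Lambda_{t-}=\inf\{x>0:\alpha\,\mathbb{P}(\tau\ge t,\ X_{t-}\in(0,x])<x\}$ at all $t\ge0$. Topology: every $f\in D([0,\infty))$ is regarded as an element of $D([-1,\infty))$ by setting $f(x)=f(0-)$ for $x\in[-1,0)$. M1 denotes the Skorokhod M1 topology. $f^n\to f$ in $(D([-1,\infty)),\mathrm{M1})$ means that there is a sequence $T_N\nearrow\infty$ such that $f^n\to f$ in $(D([-1,T_N]),\mathrm{M1})$ for all $N$. For non-decreasing functions, convergence in $(D([-1,T]),\mathrm{M1})$ is equivalent to $f^n(t)\to f(t)$ for all $t$ in a dense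 subset of $[-1,T]$ containing $-1$ and $T$.
   Formalization: At t=0 the jump condition is claimed only when P(X_{0-}=0)=0; otherwise it fails, e.g. α=1, X^n_{0-}=1/(n+1), X_{0-}=0, where Λ jumps by 1 at 0 but the infimum is 0. All t>0 are covered without restriction. *)

(* Defs.v *)
From HB Require Import structures.
From mathcomp Require Import all_boot all_order all_algebra.
From mathcomp Require Import all_classical all_reals all_analysis.
Set Implicit Arguments.
Unset Strict Implicit.
Unset Printing Implicit Defensive.
Import Order.TTheory GRing.Theory Num.Theory.
Import numFieldNormedType.Exports.
Local Open Scope classical_set_scope.
Local Open Scope ring_scope.

(* An element f of D([0, oo)) together with its prescribed value f(0-) is
   encoded as a function on the whole line that is constant, equal to f(0-), on
   the negative half-line.  The left limit of f at 0 is then f(0-), and the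
   restriction of f to [-1, oo) is the extension of f by f(0-). *)
Definition left_limit (R : realType) (f : R -> R) (t : R) : R :=
  lim (f s @[s --> t^'-]).

Definition D0 (R : realType) (f : R -> R) : Prop :=
  [/\ forall s t, s < 0 -> t < 0 -> f s = f t,
      forall t, f s @[s --> t^'+] --> f t &
      forall t, cvg (f s @[s --> t^'-])].

Definition M (R : realType) (l : R -> R) : Prop :=
  [/\ D0 l, left_limit l 0 = 0 & {homo l : s t / s <= t}].

(* Pairs are (time, value).  A path in D([a, b]) has no jump at a, whence the
   case distinction for its left limit. *)
Definition left_limit_from (R : realType) (a : R) (f : R -> R) (t : R) : R :=
  if t <= a then f t else left_limit f t.

Definition completed_graph (R : realType) (a b : R) (f : R -> R) :
    set (R * R) :=
  [set p | a <= p.1 <= b /\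
     Num.min (left_limit_from a f p.1) (f p.1) <= p.2
       <= Num.max (left_limit_from a f p.1) (f p.1)].

Definition graph_le (R : realType) (a : R) (f : R -> R) (p q : R * R) : Prop :=
  p.1 < q.1 \/
  (p.1 = q.1 /\
   `|left_limit_from a f p.1 - p.2| <= `|left_limit_from a f p.1 - q.2|).

Definition parametric_representation (R : realType) (a b : R) (f : R -> R)
    (g : R -> R * R) : Prop :=
  [/\ {within `[0, 1], continuous g},
      g @` `[0, 1] = completed_graph a b f &
      forall s t, 0 <= s -> s <= t -> t <= 1 -> graph_le a f (g s) (g t)].

(* The infimum is taken in \bar R, where the infimum of the empty set is +oo. *)
Definition m1_dist (R : realType) (a b : R) (f1 f2 : R -> R) : \bar R :=
  ereal_inf [set r | exists g1 g2 : R -> R * R,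
    [/\ parametric_representation a b f1 g1,
        parametric_representation a b f2 g2 &
        r = ereal_sup
          [set (Num.max `|(g1 s).1 - (g2 s).1| `|(g1 s).2 - (g2 s).2|)%:E
             | s in `[0, 1]]]].

Definition m1_cvg (R : realType) (f_ : nat -> R -> R) (f : R -> R) : Prop :=
  exists T_ : nat -> R,
    [/\ nondecreasing_seq T_, T_ N @[N --> \oo] --> +oo &
        forall N, m1_dist (-1) (T_ N) (f_ n) f @[n --> \oo] --> 0%E].

(* The sigma-algebra generated by the variables Y t, t in I. *)
Definition sigma_gen (R : realType) d (Om : measurableType d)
    (I : set R) (Y : R -> Om -> R) : set (set Om) :=
  <<s [set A | exists t, I t /\
         exists U : set R, measurable U /\ A = Y t @^-1` U] >>.

Definition indep_of (R : realType) d (Om : measurableType d)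
    (P : probability Om R) (X : Om -> R) (F : set (set Om)) : Prop :=
  forall (U : set R) (A : set Om), measurable U -> F A ->
    P (X @^-1` U `&` A) = (P (X @^-1` U) * P A)%E.

(* Only the variables B t with 0 <= t matter.  All paths are continuous, so that
   the events below are measurable without completing P. *)
Definition brownian_motion (R : realType) d (Om : measurableType d)
    (P : probability Om R) (B : R -> Om -> R) : Prop :=
  [/\ forall t, 0 <= t -> measurable_fun setT (B t),
      forall w, B 0 w = 0,
      forall w, {within `[0, +oo[, continuous (fun t => B t w)},
      forall s t, 0 <= s -> s < t -> forall U : set R, measurable U ->
        P ((fun w => B t w - B s w) @^-1` U) =
        normal_prob 0 (Num.sqrt (t - s)) U &
      forall s t, 0 <= s -> s < t ->
        indep_of P (fun w => B t w - B s w) (sigma_gen `[0, s] B)].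

Definition mv_data (R : realType) d (Om : measurableType d)
    (P : probability Om R) (X0 : Om -> R) (B : R -> Om -> R) : Prop :=
  [/\ measurable_fun setT X0, brownian_motion P B &
      indep_of P X0 (sigma_gen `[0, +oo[ B)].

Definition mvX (R : realType) (Om : Type) (X0 : Om -> R) (B : R -> Om -> R)
    (L : R -> R) (w : Om) (t : R) : R :=
  if t < 0 then X0 w else X0 w + B t w - L t.

Definition tau (R : realType) (Om : Type) (X0 : Om -> R) (B : R -> Om -> R)
    (L : R -> R) (w : Om) : \bar R :=
  ereal_inf [set t%:E | t in [set t | 0 <= t /\ mvX X0 B L w t <= 0]].

Definition mv_solution (R : realType) d (Om : measurableType d)
    (P : probability Om R) (alpha : R) (X0 : Om -> R) (B : R -> Om -> R)
    (L : R -> R) : Prop :=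
  M L /\
  forall t, 0 <= t ->
    (L t)%:E = (alpha%:E * P [set w | (tau X0 B L w <= t%:E)%E])%E.

(* The interval is open at 0.  At t = 0, where the left limit of the state is X0,
   an atom of X0 at 0 is therefore not counted on the right-hand side, although
   it is absorbed at once and contributes to the jump L 0 of any solution: when
   P (X0 <= 0) > 0, no solution satisfies the condition at 0. *)
Definition physical_jump_at (R : realType) d (Om : measurableType d)
    (P : probability Om R) (alpha : R) (X0 : Om -> R) (B : R -> Om -> R)
    (L : R -> R) (t : R) : Prop :=
  L t - left_limit L t =
  inf [set x : R | 0 < x /\
    (alpha%:E * P [set w | (t%:E <= tau X0 B L w)%E /\
                           (0 < left_limit (mvX X0 B L w) t <= x)%R] < x%:E)%E].

Definition physical_solution (R : realType) d (Om : measurableType d)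
    (P : probability Om R) (alpha : R) (X0 : Om -> R) (B : R -> Om -> R)
    (L : R -> R) : Prop :=
  mv_solution P alpha X0 B L /\
  forall t, 0 <= t -> physical_jump_at P alpha X0 B L t.

Definition finite_mean (R : realType) d (Om : measurableType d)
    (P : probability Om R) (X : Om -> R) : Prop :=
  ('E_P[fun w => (`|X w|)%R] < +oo)%E.

(* Weak convergence of the laws; the variables may live on different spaces. *)
Definition cvg_in_law (R : realType) (d_ : nat -> measure_display)
    (Om_ : forall n, measurableType (d_ n))
    (P_ : forall n, probability (Om_ n) R) (X_ : forall n, Om_ n -> R)
    d (Om : measurableType d) (P : probability Om R) (X : Om -> R) : Prop :=
  forall f : R -> R, continuous f -> (exists C : R, forall x, `|f x| <= C) ->
    ('E_(P_ n)[f \o X_ n])%E @[n --> \oo] --> ('E_P[f \o X])%E.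

(* Main.v *)
From HB Require Import structures.
Require Import Defs.
From mathcomp Require Import all_boot all_order all_algebra.
From mathcomp Require Import all_classical all_reals all_analysis.
From mathcomp Require Import measurable_realfun lra.
Set Implicit Arguments.
Unset Strict Implicit.
Unset Printing Implicit Defensive.
Import Order.TTheory GRing.Theory Num.Theory.
Import numFieldNormedType.Exports.
Local Open Scope classical_set_scope.
Local Open Scope ring_scope.

(* Write X(t-) for the left limit of the state and J(t, x) for
   alpha P(tau >= t, 0 < X(t-) <= x).

   Every solution jumps at least as much as the physical condition requires:
   otherwise alpha P(tau > t, X(t) <= y) >= y for all small y, and since the
   increment of B over [t, t + h] is symmetric and non-degenerate, strictly more
   than L(t + h) - L(t) would be absorbed during [t, t + h].

   Conversely let J(t, x) < x.  If a physical solution satisfies a strict form of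
   this inequality just before t, with X(s-) replaced by X(s-) plus the minimum of
   the increment of B over [s, s + h], then it cannot increase by x on [s, s + h[:
   at the first time sigma where it would, the mass in (0, z] just before sigma is
   what remains after the absorption on [s, sigma[, so the physical condition
   forces a jump that is too small.  The strict inequality is inherited by the
   approximating solutions for large n: it bounds from above the mass that has not
   yet been absorbed (known through the values of the solutions) minus the mass
   staying above a barrier, and the latter is lower semicontinuous in n, because
   all Brownian motions have the same law and X0 is independent of B.  Since this
   only uses open conditions on paths, no fact about the way in which X hits 0 is
   needed. *)

(** * Cadlag paths and hitting times *)

Section monotone_cadlag.
Context {R : realType}.
Variable L : R -> R.
Hypothesis ML : M L.

Let Lmono (s t : R) : s <= t -> L s <= L t.
Proof. by case: ML => _ _; apply. Qed.

Lemma M_cvg_left (t : R) : L s @[s --> t^'-] --> left_limit L t.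
Proof. by case: ML => -[_ _ /(_ t)]. Qed.

Lemma left_limit_ge (v t : R) : v < t -> L v <= left_limit L t.
Proof.
move=> vt; case: ML => -[_ _ /(_ t) cL] _ _; rewrite /left_limit; apply: (limr_ge cL).
near=> u; apply: Lmono; near: u; exact: nbhs_left_ge.
Unshelve. all: by end_near. Qed.

Lemma left_limit_le (c t : R) : (forall v : R, v < t -> L v <= c) -> left_limit L t <= c.
Proof.
move=> Lc; case: ML => -[_ _ /(_ t) cL] _ _; rewrite /left_limit; apply: (limr_le cL).
near=> u; apply: Lc; near: u; exact: nbhs_left_lt.
Unshelve. all: by end_near. Qed.

Lemma left_limit_le_self (t : R) : left_limit L t <= L t.
Proof. by apply: left_limit_le => v vt; apply: Lmono; exact: ltW. Qed.

Lemma left_limit_near (e t : R) : 0 < e -> exists2 v, v < t & left_limit L t - e < L v.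
Proof.
move=> e0; apply: contrapT => H.
have : left_limit L t <= left_limit L t - e.
  apply: left_limit_le => v vt; rewrite leNgt; apply/negP => ?.
  by apply: H; exists v.
lra.
Qed.

Lemma M_neg (t : R) : t < 0 -> L t = 0.
Proof.
move=> t0; case: (ML) => -[cL _ _] <- _; apply/esym.
rewrite /left_limit; apply: cvg_lim => //.
apply: cvg_near_cst; near=> s.
by apply: cL => //; near: s; exact: nbhs_left_lt.
Unshelve. all: by end_near. Qed.

Lemma M_left_limit0 : left_limit L 0 = 0.
Proof. by case: ML. Qed.

Lemma M_ge0 (t : R) : 0 <= L t.
Proof.
have [t0|t0] := ltP t 0; first by rewrite M_neg.
apply: (le_trans _ (Lmono t0)).
by have := left_limit_le_self 0; rewrite M_left_limit0.
Qed.

(** Right-continuity at [t], extended by monotonicity to every [u] below [t + h], including those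
    before [t]. *)
Lemma M_right (e t : R) : 0 < e -> exists2 h : R, 0 < h & forall u : R, u < t + h -> L u < L t + e.
Proof.
move=> e0; case: (ML) => -[_ /(_ t) /cvgrPdist_lt /(_ e e0) H _] _ _.
case: H => h /= h0 H; exists h => // u uth.
have [ut|tu] := leP u t; first by rewrite ltr_pwDr // Lmono.
have : `|L t - L u| < e by apply: H => //=; rewrite ltr_norml; apply/andP; split; lra.
rewrite ltr_norml; lra.
Qed.

End monotone_cadlag.

(* On one dyadic grid, B is a function of a sequence of independent increments,
   and these grids are nested. *)
Definition dyadic {R : realType} (m j : nat) : R := j%:R / 2 ^+ m.

Lemma dyadic_ge0 {R : realType} m j : 0 <= @dyadic R m j.
Proof. by rewrite divr_ge0 // exprn_ge0. Qed.

Lemma dyadic_dense {R : realType} (a b : R) : 0 <= a -> a < b ->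
  exists m j, a < dyadic m j < b.
Proof.
move=> a0 ab.
(* The mesh [2 ^- m] is smaller than [b - a], so the first grid point after [a] lies before [b]. *)
have [m mP] : exists m : nat, (b - a)^-1 < 2 ^+ m.
  exists (Num.truncn (b - a)^-1).+1.
  apply: (lt_trans (truncnS_gt _)); rewrite -natrX ltr_nat; exact: ltn_expl.
have m0 : 0 < 2 ^+ m :> R by rewrite exprn_gt0.
exists m, (Num.truncn (a * 2 ^+ m)).+1.
have h2 := truncnS_gt (a * 2 ^+ m).
have h1 := truncn_le (a * 2 ^+ m); rewrite mulr_ge0 ?exprn_ge0 // in h1.
rewrite /dyadic ltr_pdivlMr // h2 /= ltr_pdivrMr //.
have : 1 < (b - a) * 2 ^+ m.
  by rewrite mulrC -ltr_pdivrMr ?subr_gt0 // mul1r.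
rewrite mulrBl -natr1; lra.
Qed.

Lemma natSinv_lt {R : realType} (e : R) : 0 < e ->
  exists k : nat, forall n, (k <= n)%N -> n.+1%:R^-1 < e.
Proof. by move=> e0; have [k _ Hk] := near_infty_natSinv_lt (PosNum e0); exists k. Qed.

Section hitting_time.
Context {R : realType} {T : Type}.
Variables (X0 : T -> R) (B : R -> T -> R) (L : R -> R).
Hypothesis B0 : forall w, B 0 w = 0.
Hypothesis cB : forall w, {within `[0, +oo[, continuous (fun t => B t w)}.
Hypothesis ML : M L.

Let Lmono (s t : R) : s <= t -> L s <= L t.
Proof. by case: ML => _ _; apply. Qed.

Lemma path_cont w (u e : R) : 0 <= u -> 0 < e ->
  exists2 h : R, 0 < h & forall v : R, 0 <= v -> `|v - u| < h -> `|B v w - B u w| < e.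
Proof.
move=> u0 e0; have /subspace_continuousP cBw := (@cB w); have := cBw u.
rewrite /= in_itv /= u0 => /(_ isT) /cvgrPdist_lt /(_ e e0) [h /= h0 H].
exists h => // v v0 vu; rewrite distrC; apply: H; first by rewrite /= distrC.
by rewrite /= in_itv /= v0.
Qed.

Lemma mvXE w (t : R) : 0 <= t -> mvX X0 B L w t = X0 w + B t w - L t.
Proof. by rewrite /mvX ltNge => ->. Qed.

Lemma left_limit_mvX w (t : R) : 0 <= t ->
  left_limit (mvX X0 B L w) t = X0 w + B t w - left_limit L t.
Proof.
rewrite le_eqVlt => /predU1P[<-|t0].
  (* At time 0 the left limit is the initial condition, because [mvX] equals [X0] on negative times;
     the formula agrees since [B 0] and the left limit of [L] at 0 both vanish. *)
  rewrite B0 (M_left_limit0 ML) addr0 subr0 /left_limit; apply: cvg_lim => //.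
  apply: cvg_near_cst; near=> s.
  have s0 : s < 0 by near: s; exact: nbhs_left_lt.
  by rewrite /mvX s0.
rewrite /left_limit; apply: cvg_lim => //.
have : (X0 w + B s w - L s) @[s --> t^'-] --> X0 w + B t w - left_limit L t.
  apply: cvgB; last exact: M_cvg_left.
  apply: cvgD; first exact: cvg_cst.
  apply/cvgrPdist_lt => e e0.
  have [h h0 H] := path_cont w (ltW t0) e0.
  near=> s; rewrite distrC; apply: H.
    by near: s; exact: nbhs_left_ge.
  rewrite ltr_distl; apply/andP; split; first by near: s; apply: nbhs_left_gt; lra.
  by rewrite (@lt_trans _ _ t) ?ltrDl //; near: s; exact: nbhs_left_lt.
apply: cvg_trans; apply: near_eq_cvg; near=> s; rewrite mvXE //.
by near: s; exact: nbhs_left_ge.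
Unshelve. all: by end_near. Qed.

(** The path of [B] is continuous and [L], being non-decreasing and right-continuous, is upper
    semicontinuous, so the state is lower semicontinuous in time, even across the jumps of [L]. *)
Lemma state_lsc w (u c : R) : 0 <= u -> c < X0 w + B u w - L u ->
  exists2 h : R, 0 < h &
    forall v : R, 0 <= v -> `|v - u| < h -> c < X0 w + B v w - L v.
Proof.
move=> u0 cX; pose e := (X0 w + B u w - L u - c) / 2.
have e0 : 0 < e by rewrite /e; lra.
have [h1 h10 H1] := path_cont w u0 e0.
have [h2 h20 H2] := M_right ML u e0.
exists (Num.min h1 h2); first by rewrite lt_min h10.
move=> v v0; rewrite lt_min => /andP[/(H1 v v0) + vh2].
have {}/H2 : v < u + h2 by move: vh2; rewrite ltr_norml; lra.
rewrite ltr_norml /e; lra.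
Qed.

Lemma le_tauP w (s : R) : (s%:E <= tau X0 B L w)%E <->
  forall u : R, 0 <= u -> u < s -> 0 < X0 w + B u w - L u.
Proof.
split=> [stau u u0 us|H].
  rewrite ltNge; apply/negP => Xu.
  have : (tau X0 B L w <= u%:E)%E.
    by apply: ereal_inf_lbound; exists u => //; split => //; rewrite mvXE.
  by move=> /(le_trans stau); rewrite lee_fin leNgt us.
apply: le_ereal_inf_tmp => _ [u [u0 Xu] <-]; rewrite lee_fin leNgt; apply/negP => us.
by move: Xu; rewrite mvXE // leNgt H.
Qed.

(** If the state is positive up to and including [s], lower semicontinuity keeps it positive
    slightly longer, which makes the inequality for the infimum [tau] strict. *)
Lemma lt_tauP w (s : R) : 0 <= s -> (s%:E < tau X0 B L w)%E <->
  forall u : R, 0 <= u -> u <= s -> 0 < X0 w + B u w - L u.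
Proof.
move=> s0; split=> [stau u u0 us|H].
  rewrite ltNge; apply/negP => Xu.
  have : (tau X0 B L w <= u%:E)%E.
    by apply: ereal_inf_lbound; exists u => //; split => //; rewrite mvXE.
  by move=> /(lt_le_trans stau); rewrite lte_fin ltNge us.
have [h h0 Hh] := state_lsc s0 (H s s0 (lexx _)).
apply: (@lt_le_trans _ _ (s + h)%:E); first by rewrite lte_fin ltrDl.
apply/le_tauP => u u0 ush.
have [us|su] := leP u s; first exact: H.
by apply: Hh => //; rewrite ltr_norml; apply/andP; split; lra.
Qed.

(** A positive lower semicontinuous function on a compact interval has a positive lower bound.
    Compactness is used as a covering property along the filter of large [k]. *)
Lemma state_bounded_away w (s : R) : (forall u : R, 0 <= u -> u <= s -> 0 < X0 w + B u w - L u) ->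
  exists k : nat, forall u : R, 0 <= u -> u <= s -> k.+1%:R^-1 <= X0 w + B u w - L u.
Proof.
move=> H.
have /compact_near_coveringP/near_covering_withinP := @segment_compact R 0 s.
move=> /(_ nat \oo (fun k u => k.+1%:R^-1 <= X0 w + B u w - L u)).
case.
  move=> u /=; rewrite in_itv /= => /andP[u0 us].
  have Xu := H u u0 us.
  have hX : (X0 w + B u w - L u) / 2 < X0 w + B u w - L u by rewrite ltr_pdivrMr // mulr_natr mulr2n ltrDl.
  have [h h0 Hh] := state_lsc u0 hX.
  have [k Hk] := natSinv_lt (divr_gt0 Xu (@ltr0Sn R 1)).
  exists ([set v | `|v - u| < h], [set n | (k <= n)%N]) => /=.
    split; last by exists k.
    by exists h => //= v; rewrite /= distrC.
  move=> [v n] /= [vu kn]; rewrite in_itv /= => /andP[v0 vs].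
  by apply: ltW; apply: lt_trans (Hk n kn) (Hh v v0 vu).
move=> k _ /(_ k (leqnn k)) Hk; exists k => u u0 us.
by apply: Hk; rewrite /= in_itv /= u0.
Qed.

End hitting_time.

Lemma measurable_dyadic_event {R : realType} d (T : measurableType d)
    (X0 : T -> R) (B : R -> T -> R) (J : set R) (a : R -> R) :
  measurable_fun setT X0 -> (forall u, J u -> measurable_fun setT (B u)) ->
  measurable [set w | forall m j, J (dyadic m j) ->
                a (dyadic m j) <= X0 w + B (dyadic m j) w].
Proof.
move=> mX mB.
rewrite (_ : mkset _ = \bigcap_m \bigcap_j [set w | J (dyadic m j) ->
                a (dyadic m j) <= X0 w + B (dyadic m j) w]); last first.
  apply/seteqP; split => [w H m _ j _|w H m j]; [exact: H|exact: H].
apply: bigcapT_measurable => m; apply: bigcapT_measurable => j.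
have [Ju|nJ] := pselect (J (dyadic m j)); last first.
  rewrite (_ : mkset _ = setT) //; by apply/seteqP; split => w //= _ /nJ.
rewrite (_ : mkset _ = (fun w => X0 w + B (dyadic m j) w) @^-1` `[a (dyadic m j), +oo[).
  rewrite -[X in measurable X]setTI; by apply: measurable_funD => //; exact: mB.
apply/seteqP; split => w /=; rewrite in_itv /= andbT; first exact.
by move=> ? _.
Qed.

(** The event is a countable union, over margins [k.+1%:R^-1], of countably many conditions at
    dyadic times and one at [s]. Only the variables [B u] with [u <= s] are involved, so that the
    lemma also applies to the sigma-algebra of the past. *)
Lemma measurable_lt_tau {R : realType} d (T : measurableType d)
    (X0 : T -> R) (B : R -> T -> R) (L : R -> R) (s : R) :
  (forall w, {within `[0, +oo[, continuous (fun t => B t w)}) -> M L -> 0 <= s ->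
  measurable_fun setT X0 -> (forall u : R, 0 <= u <= s -> measurable_fun setT (B u)) ->
  measurable [set w | (s%:E < tau X0 B L w)%E].
Proof.
move=> cB ML s0 mX mB.
have mXs : measurable_fun setT (fun w => X0 w + B s w).
  by apply: measurable_funD => //; apply: mB; rewrite s0 lexx.
have -> : [set w | (s%:E < tau X0 B L w)%E] = \bigcup_(k : nat)
   ([set w | forall m j, 0 <= @dyadic R m j <= s ->
       L (dyadic m j) + k.+1%:R^-1 <= X0 w + B (dyadic m j) w] `&`
    (fun w => X0 w + B s w) @^-1` `[L s + k.+1%:R^-1, +oo[).
  apply/seteqP; split => w /=.
  move=> /(lt_tauP _ cB ML _ s0) /(state_bounded_away cB ML) [k Hk].
  exists k => //; split => [m j|].
    by move=> /andP[u0 us]; rewrite -lerBrDl; exact: Hk.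
  by rewrite /= in_itv /= andbT -lerBrDl; exact: Hk.
move=> [k _ [/= H]]; rewrite in_itv /= andbT => Hs.
have k0 : 0 < k.+1%:R^-1 :> R by rewrite invr_gt0.
set c := k.+1%:R^-1 in H Hs k0; move: c H Hs k0 => c H Hs k0.
apply/(lt_tauP _ cB ML _ s0) => u u0; rewrite le_eqVlt => /predU1P[->|us]; first lra.
(* A dyadic time [v] slightly after [u] satisfies [L u <= L v], and the margin absorbs the
   oscillation of [B] between [u] and [v]. The time [s] was treated apart, since no dyadic time of
   the event need lie after it. *)
have [h h0 Hh] := path_cont cB w u0 k0.
have uh : u < Num.min (u + h) s by rewrite lt_min us ltrDl h0.
have [m [j /andP[uv]]] := dyadic_dense u0 uh.
rewrite lt_min => /andP[vh vs].
have := H m j; rewrite dyadic_ge0 (ltW vs) => /(_ isT).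
have := Hh _ (dyadic_ge0 m j); rewrite !ltr_norml => /(_ ltac:(lra)).
have : L u <= L (dyadic m j) by case: ML => _ _; apply; exact: ltW.
lra.
apply: bigcupT_measurable => k; apply: measurableI.
    exact: (@measurable_dyadic_event R d T X0 B [set u | 0 <= u <= s] (fun u => L u + k.+1%:R^-1)).
  rewrite -[X in measurable X]setTI; exact: mXs.
Qed.

(** * M1 convergence and probabilities as real numbers *)

(** At M1 distance less than [rho], the point [(u, L_ n u)] is within [rho], in both coordinates, of
    a point [(u', v')] of the completed graph of [L], where [v'] lies between the left limit and the
    value of [L] at [u']. The lower bound loses [rho] in time twice: from [u] to [u'], and from the
    left limit at [u'] to a value of [L]. *)
Lemma m1_cvg_bounds {R : realType} (L_ : nat -> R -> R) (L : R -> R) :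
  (forall n, M (L_ n)) -> M L -> m1_cvg L_ L ->
  forall K rho : R, 0 < rho -> exists N : nat, forall n, (N <= n)%N ->
    forall u : R, -1 <= u -> u <= K ->
      L (u - 2 * rho) - rho <= L_ n u /\ L_ n u <= L (u + rho) + rho.
Proof.
move=> ML_ ML [T_ [_ T_oo dT]] K rho rho0.
(* One horizon [T_ i] beyond [K] is enough. *)
have [i KT] : exists i, K <= T_ i.
  have /cvgryPge/(_ K) [i _ Hi] := T_oo; exists i; exact: Hi i (leqnn i).
have Lmono (s t : R) : s <= t -> L s <= L t by case: ML => _ _; apply.
have Lnmono n (s t : R) : s <= t -> L_ n s <= L_ n t by case: (ML_ n) => _ _; apply.
have lle (f : R -> R) a u : M f -> left_limit_from a f u <= f u.
  move=> Mf; rewrite /left_limit_from; case: ifP => // _.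
  exact: left_limit_le_self.
have llg (u : R) : L (u - rho) <= left_limit_from (-1) L u.
  rewrite /left_limit_from; case: ifP => _; first by apply: Lmono; lra.
  by apply: left_limit_ge => //; lra.
have : \forall n \near \oo, (m1_dist (-1) (T_ i) (L_ n) L < rho%:E)%E.
  move: (dT i) => /fine_cvgP [fT].
  move=> /cvgrPdist_lt /(_ rho rho0) H.
  near=> n.
  have nf : m1_dist (-1) (T_ i) (L_ n) L \is a fin_num by near: n.
  have : `|0 - fine (m1_dist (-1) (T_ i) (L_ n) L)| < rho by near: n.
  rewrite sub0r normrN => /(le_lt_trans (ler_norm _)).
  by rewrite -lte_fin fineK.
move=> [N _ HN]; exists N => n Nn u um1 uK.
have /= /ereal_inf_lt [_ [g1 [g2 [[_ im1 _] [_ im2 _] ->]]] slt] := HN n Nn.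
have : completed_graph (-1) (T_ i) (L_ n) (u, L_ n u).
  split => /=; first by rewrite um1 (le_trans uK KT).
  by rewrite ge_min le_max lexx !orbT.
rewrite -im1 => -[s s01 g1s].
have : completed_graph (-1) (T_ i) L (g2 s) by rewrite -im2; exists s.
case g2s : (g2 s) => [u' v'] [/= _ /andP[vlo vhi]].
have : ((Num.max `|(g1 s).1 - (g2 s).1| `|(g1 s).2 - (g2 s).2|)%:E < rho%:E)%E.
  by apply: le_lt_trans slt; apply: ereal_sup_ubound; exists s.
rewrite g1s g2s /= lte_fin gt_max !ltr_norml => /andP[/andP[h1 h2] /andP[h3 h4]].
rewrite (min_idPl (lle _ _ _ ML)) in vlo; rewrite (max_idPr (lle _ _ _ ML)) in vhi.
have h5 := llg u'.
have h6 : L (u - 2 * rho) <= L (u' - rho) by apply: Lmono; lra.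
have h7 : L u' <= L (u + rho) by apply: Lmono; lra.
by split; lra.
Unshelve. all: by end_near. Qed.

Section prob.
Context {R : realType} {d} {T : measurableType d}.
Variable P : probability T R.

Definition prob (A : set T) : R := fine (P A).

Lemma probE A : measurable A -> P A = (prob A)%:E.
Proof. by move=> mA; rewrite /prob fineK // fin_num_measure. Qed.

Lemma prob_ge0 A : 0 <= prob A.
Proof. exact: fine_ge0. Qed.

Lemma prob_le A C : measurable A -> measurable C -> A `<=` C -> prob A <= prob C.
Proof.
by move=> mA mC AC; rewrite -lee_fin -!probE //; apply: le_measure; rewrite ?inE.
Qed.

Lemma prob_setT : prob setT = 1.
Proof. by rewrite /prob probability_setT. Qed.

Lemma prob_le1 A : measurable A -> prob A <= 1.
Proof. by move=> mA; rewrite -prob_setT; apply: prob_le. Qed.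

Lemma prob_setU A C : measurable A -> measurable C -> A `&` C = set0 ->
  prob (A `|` C) = prob A + prob C.
Proof.
move=> mA mC AC0; apply: EFin_inj; rewrite EFinD -!probE //; last exact: measurableU.
by rewrite measureU.
Qed.

Lemma prob_setU_le A C : measurable A -> measurable C ->
  prob (A `|` C) <= prob A + prob C.
Proof.
move=> mA mC; rewrite -lee_fin EFinD -!probE //; last exact: measurableU.
exact: measureU2.
Qed.

Lemma prob_setD A C : measurable A -> measurable C -> C `<=` A ->
  prob (A `\` C) = prob A - prob C.
Proof.
move=> mA mC CA; have CD : C `&` (A `\` C) = set0.
  by apply/seteqP; split => // w [Cw []].
have := prob_setU mC (measurableD mA mC) CD.
by rewrite setDUK // => ->; lra.
Qed.

Lemma prob_setC A : measurable A -> prob (~` A) = 1 - prob A.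
Proof. by move=> mA; rewrite -setTD prob_setD // prob_setT. Qed.

Lemma prob_cvg_bigcup (F : nat -> set T) : (forall n, measurable (F n)) ->
  nondecreasing_seq F -> prob (F n) @[n --> \oo] --> prob (\bigcup_n F n).
Proof.
move=> mF ndF; have := @nondecreasing_cvg_mu _ _ _ P F mF (bigcupT_measurable _ mF) ndF.
have mU : measurable (\bigcup_n F n) by exact: bigcupT_measurable.
by rewrite [X in _ --> X](probE mU) => /fine_cvg.
Qed.

Lemma prob_cvg_bigcap (F : nat -> set T) : (forall n, measurable (F n)) ->
  nonincreasing_seq F -> prob (F n) @[n --> \oo] --> prob (\bigcap_n F n).
Proof.
move=> mF ndF.
have := @nonincreasing_cvg_mu _ _ _ P F _ mF (bigcapT_measurable mF) ndF.
have mI : measurable (\bigcap_n F n) by exact: bigcapT_measurable.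
rewrite [X in _ --> X](probE mI) => /(_ _)/fine_cvg; apply.
by apply: (le_lt_trans (probability_le1 P (mF 0%N))); rewrite ltry.
Qed.

(** Fatou's lemma for events: the tail intersections [G n] increase to a set containing [A]. *)
Lemma prob_liminf (F : nat -> set T) A : (forall n, measurable (F n)) ->
  measurable A -> (forall w, A w -> \forall n \near \oo, F n w) ->
  forall e : R, 0 < e -> \forall n \near \oo, prob A - e < prob (F n).
Proof.
move=> mF mA AF e e0.
pose G n := \bigcap_(k in [set k | (n <= k)%N]) F k.
have mG n : measurable (G n) by apply: bigcap_measurable => //; exists n => /=.
have ndG : nondecreasing_seq G.
  by move=> m n mn; apply/subsetPset => w Gw k /= nk; apply: Gw; exact: leq_trans nk.
have AG : A `<=` \bigcup_n G n.
  by move=> w /AF [N _ HN]; exists N.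
have AGe : prob A <= prob (\bigcup_n G n).
  by apply: prob_le => //; exact: bigcupT_measurable.
have /cvgrPdist_lt /(_ e e0) [N _ HN] := prob_cvg_bigcup mG ndG.
exists N => // n Nn; have := HN n Nn; rewrite ltr_norml => /andP[_ h].
have : prob (G n) <= prob (F n) by apply: prob_le => // w; apply => /=.
by move=> ?; rewrite ltrBlDr; lra.
Qed.

End prob.

(** * Solutions and increments of physical solutions *)

Section solution.
Context {R : realType} {d : measure_display} {Om : measurableType d}.
Variables (P : probability Om R) (alpha : R) (X0 : Om -> R) (B : R -> Om -> R).
Variable L : R -> R.
Hypothesis halpha : 0 < alpha.
Hypothesis hdata : mv_data P X0 B.
Hypothesis hsol : mv_solution P alpha X0 B L.

Let ML : M L. Proof. by case: hsol. Qed.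
Let Lmono (s t : R) : s <= t -> L s <= L t.
Proof. by case: ML => _ _; apply. Qed.
Let mX0 : measurable_fun setT X0. Proof. by case: hdata. Qed.
Let mB (t : R) : 0 <= t -> measurable_fun setT (B t).
Proof. by case: hdata => _ [+ _ _ _ _] _; apply. Qed.
Let B0 w : B 0 w = 0. Proof. by case: hdata => _ [_ + _ _ _] _; apply. Qed.
Let cB w : {within `[0, +oo[, continuous (fun t => B t w)}.
Proof. by case: hdata => _ [_ _ + _ _] _; apply. Qed.

Lemma measurable_state (c t : R) I : 0 <= t -> measurable I ->
  measurable [set w | I (X0 w + B t w - c)].
Proof.
move=> t0 mI; have mf : measurable_fun setT (fun w => X0 w + B t w - c).
  apply: measurable_funB => //; apply: measurable_funD => //; exact: mB.
by rewrite -[X in measurable X]setTI; exact: mf.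
Qed.

Lemma measurable_gt_tau (s : R) : 0 <= s ->
  measurable [set w | (s%:E < tau X0 B L w)%E].
Proof. by move=> s0; apply: measurable_lt_tau => // u /andP[u0 _]; exact: mB. Qed.

(** For [s > 0], times in [[0, s[] that increase to [s]; starting at 0 keeps them in the domain of
    [solution_gt]. *)
Let r (s : R) (k : nat) := s - s * k.+1%:R^-1.

Let r_ge0 s k : 0 <= s -> 0 <= r s k.
Proof.
move=> s0; rewrite /r subr_ge0 ler_piMr // invf_le1 ?ltr0Sn //.
by rewrite (ler_nat _ 1).
Qed.

Let r_lt s k : 0 < s -> r s k < s.
Proof. by move=> s0; rewrite /r ltrBlDr ltrDl mulr_gt0 // invr_gt0. Qed.

Let ge_tauE s : 0 < s -> [set w | (s%:E <= tau X0 B L w)%E] =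
  \bigcap_k [set w | ((r s k)%:E < tau X0 B L w)%E].
Proof.
move=> s0; apply/seteqP; split => w /= H.
  by move=> k _ /=; apply: lt_le_trans H; rewrite lte_fin r_lt.
apply/(le_tauP _ _ L) => // u u0 us.
have su : 0 < s - u by rewrite subr_gt0.
have [k Hk] := natSinv_lt (divr_gt0 su s0).
have := H k I => /(lt_tauP _ cB ML _ (r_ge0 k (ltW s0))); apply => //.
have := ltW (Hk k (leqnn k)); rewrite ler_pdivlMr // mulrC /r.
by move: (s * _) => c; lra.
Qed.

Lemma measurable_ge_tau (s : R) : 0 <= s ->
  measurable [set w | (s%:E <= tau X0 B L w)%E].
Proof.
rewrite le_eqVlt => /predU1P[<-|s0].
  rewrite (_ : mkset _ = setT) //; apply/seteqP; split => w //= _.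
  by apply/le_tauP => // u u0; rewrite ltNge u0.
rewrite ge_tauE //; apply: bigcapT_measurable => k; apply: measurable_gt_tau.
exact/r_ge0/ltW.
Qed.

Lemma solution_gt (s : R) : 0 <= s ->
  L s = alpha * (1 - prob P [set w | (s%:E < tau X0 B L w)%E]).
Proof.
move=> s0; case: hsol => _ /(_ s s0).
rewrite -(prob_setC _ (measurable_gt_tau s0)).
rewrite (_ : ~` _ = [set w | (tau X0 B L w <= s%:E)%E]); last first.
  by apply/seteqP; split => w /=; rewrite leNgt => /negP.
rewrite probE -?EFinM; first by move=> [].
rewrite (_ : mkset _ = ~` [set w | (s%:E < tau X0 B L w)%E]).
  exact/measurableC/measurable_gt_tau.
by apply/seteqP; split => w /=; rewrite leNgt => /negP.
Qed.

(** One inequality is monotonicity of the probability; the other lets [k] tend to infinity in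
    [solution_gt] at the times [r s k], by continuity from above. At 0 both sides vanish. *)
Lemma solution_ge (s : R) : 0 <= s ->
  left_limit L s = alpha * (1 - prob P [set w | (s%:E <= tau X0 B L w)%E]).
Proof.
move=> s0; have mge := measurable_ge_tau s0.
have := s0; rewrite le_eqVlt => /predU1P[<-|sp].
  rewrite (M_left_limit0 ML) (_ : mkset _ = setT) ?prob_setT ?subrr ?mulr0 //.
  apply/seteqP; split => w //= _.
  by apply/le_tauP => // u u0; rewrite ltNge u0.
apply/eqP; rewrite eq_le; apply/andP; split.
  apply: left_limit_le => // v vs; have [v0|v0] := ltP v 0.
    by rewrite (M_neg ML) // mulr_ge0 ?subr_ge0 ?prob_le1 // ltW.
  rewrite (solution_gt v0) ler_pM2l // lerD2l lerN2; apply: prob_le => //.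
    exact: measurable_gt_tau.
  by move=> w /=; apply: lt_le_trans; rewrite lte_fin.
have cv : alpha * (1 - prob P [set w | ((r s k)%:E < tau X0 B L w)%E]) @[k --> \oo]
    --> alpha * (1 - prob P [set w | (s%:E <= tau X0 B L w)%E]).
  apply: cvgM; first exact: cvg_cst.
  apply: cvgB; first exact: cvg_cst.
  rewrite ge_tauE //; apply: (@prob_cvg_bigcap _ _ _ P (fun k => [set w | ((r s k)%:E < tau X0 B L w)%E])).
    by move=> k; apply: measurable_gt_tau; exact: r_ge0.
  move=> m n mn; apply/subsetPset => w /=; apply: le_lt_trans.
  rewrite lee_fin /r lerD2l lerN2 ler_pM2l // lef_pV2 ?posrE ?ltr0Sn //.
  by rewrite ler_nat.
rewrite -(cvg_lim _ cv) //; apply: limr_le; first by apply/cvg_ex; eexists; exact: cv.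
near=> k; rewrite -solution_gt ?r_ge0 //; apply: left_limit_ge => //; exact: r_lt.
Unshelve. all: by end_near. Qed.

Lemma measurable_jump_event (t x : R) : 0 <= t ->
  measurable [set w | (t%:E <= tau X0 B L w)%E /\
      0 < left_limit (mvX X0 B L w) t <= x].
Proof.
move=> t0; rewrite (_ : mkset _ = [set w | (t%:E <= tau X0 B L w)%E] `&`
     [set w | `]0, x]%classic (X0 w + B t w - left_limit L t)]).
  apply: measurableI; first exact: measurable_ge_tau.
  exact: measurable_state.
apply/seteqP; split => w /=; by rewrite in_itv /= (left_limit_mvX _ B0 cB ML).
Qed.

(* At the first time sg where the increment reaches x, the unabsorbed mass in
   (0, z] is at most alpha (P (tau >= sg) - P E), because on E the path is above z
   just before sg; the last hypothesis makes this smaller than z, whence the jump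
   at sg is at most z. *)
Lemma physical_increment_lt (s h x : R) (E : set Om) :
  (forall t : R, 0 <= t -> physical_jump_at P alpha X0 B L t) ->
  0 <= s -> 0 < x -> measurable E ->
  (forall w, E w -> forall u : R, 0 <= u -> u < s -> 0 < X0 w + B u w - L u) ->
  (forall w, E w -> forall u : R, s <= u -> u < s + h ->
     left_limit L s + x < X0 w + B u w) ->
  alpha * (1 - prob P E) - left_limit L s < x ->
  forall u : R, s <= u -> u < s + h -> L u - left_limit L s < x.
Proof.
move=> phys s0 x0 mE E1 E2 Ex u su ush.
rewrite ltNge; apply/negP => xu.
(* The infimum [sg] of [S] is the first time at which the increment reaches [x]; by right-continuity
   it is attained. *)
pose S := [set v | s <= v /\ x <= L v - left_limit L s].
have hS : has_inf S by split; [exists u|exists s => v []].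
pose sg := inf S.
have ssg : s <= sg by apply: lb_le_inf; [exact: hS.1|move=> v []].
have sgu : sg <= u by apply: ge_inf; [exact: hS.2|].
have sg0 : 0 <= sg by exact: le_trans ssg.
have below v : s <= v -> v < sg -> L v < left_limit L s + x.
  move=> sv vsg; rewrite ltNge; apply/negP => H.
  have : sg <= v by apply: ge_inf; [exact: hS.2|split => //; lra].
  lra.
have Lsg : left_limit L s + x <= L sg.
  rewrite leNgt; apply/negP => H.
  have [k k0 Hk] := M_right ML sg (e := left_limit L s + x - L sg) ltac:(lra).
  have [v [sv xv] vk] := inf_adherent k0 hS.
  have := Hk v vk; lra.
pose K := x + left_limit L s - alpha * (1 - prob P E).
have K0 : 0 < K by rewrite /K; lra.
have ltauE w : E w -> (sg%:E <= tau X0 B L w)%E.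
  move=> Ew; apply/(le_tauP _ _ L) => // v v0 vsg.
  have [vs|sv] := ltP v s; first exact: E1.
  have := below v sv vsg; have := E2 w Ew v sv ltac:(lra); lra.
have mge := measurable_ge_tau sg0.
have llsg := solution_ge sg0.
have probEle : prob P E <= prob P [set w | (sg%:E <= tau X0 B L w)%E].
  by apply: prob_le => // w Ew; exact: ltauE.
have llK : left_limit L sg <= x + left_limit L s - K.
  rewrite llsg /K; have := ler_wpM2l (ltW halpha) probEle; lra.
(* With [K] the slack in the last hypothesis, the unabsorbed mass outside [E] just before [sg],
   times [alpha], equals [z - K / 2], so [z] belongs to the set of the physical condition. A jump of
   at most [z] leaves the increment [K / 2] short of [x]. *)
pose z := x + left_limit L s - left_limit L sg - K / 2.
have z0 : 0 < z by rewrite /z; lra.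
have := phys sg sg0; rewrite /physical_jump_at => jump.
suff : L sg - left_limit L sg <= z by rewrite /z; lra.
rewrite jump; apply: ge_inf; first by exists 0 => y [/ltW].
split=> //.
have mA := measurable_jump_event z sg0.
rewrite probE // -EFinM lte_fin.
have : prob P [set w | (sg%:E <= tau X0 B L w)%E /\
      0 < left_limit (mvX X0 B L w) sg <= z] <=
     prob P ([set w | (sg%:E <= tau X0 B L w)%E] `\` E).
  apply: prob_le => //; first exact: measurableD.
  move=> w /= [? /andP[_]]; rewrite left_limit_mvX // => Xz; split => // Ew.
  have := E2 w Ew sg ssg ltac:(lra); move: Xz; rewrite /z; lra.
rewrite prob_setD // => /(ler_wpM2l (ltW halpha)) /le_lt_trans; apply.
rewrite mulrBr /z; move: llsg; rewrite mulrBr /K; lra.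
Qed.

End solution.

(** * Joint laws and the law of Brownian motion *)

Section joint_law.
Context {R : realType} {d d1 d2 : measure_display} {Om : measurableType d}
  {T1 : measurableType d1} {T2 : measurableType d2}.
Variables (P : probability Om R) (Y : Om -> T1) (V : Om -> T2).
Hypothesis mY : measurable_fun setT Y.
Hypothesis mV : measurable_fun setT V.
Hypothesis indYV : forall A1 A2, measurable A1 -> measurable A2 ->
  P (Y @^-1` A1 `&` V @^-1` A2) = (P (Y @^-1` A1) * P (V @^-1` A2))%E.

Lemma measurable_section_prob (C : set (T1 * T2)) : measurable C ->
  measurable_fun setT (fun y => P [set w' | C (y, V w')]).
Proof.
move=> mC; pose V' : {mfun Om >-> T2} := HB.pack V (isMeasurableFun.Build _ _ _ _ V mV).
have := measurable_fun_xsection (distribution P V') mC.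
apply: eq_measurable_fun => y _ /=; rewrite /distribution /pushforward /=.
by congr (P _); apply/seteqP; split => w; rewrite /xsection /= inE.
Qed.

(** Independence identifies the joint law with the product law on rectangles, hence everywhere, and
    Fubini applies. The target types are general so that [V] may be the identity map onto [Om] with
    a coarser sigma-algebra. *)
Lemma indep_joint_law (C : set (T1 * T2)) : measurable C ->
  P [set w | C (Y w, V w)] = (\int[P]_w P [set w' | C (Y w, V w')])%E.
Proof.
move=> mC; pose V' : {mfun Om >-> T2} := HB.pack V (isMeasurableFun.Build _ _ _ _ V mV).
pose Y' : {mfun Om >-> T1} := HB.pack Y (isMeasurableFun.Build _ _ _ _ Y mY).
have mYV : measurable_fun setT (fun w => (Y w, V w)) by exact: measurable_fun_pair.
pose YV : {mfun Om >-> (T1 * T2)%type} :=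
  HB.pack (fun w => (Y w, V w)) (isMeasurableFun.Build _ _ _ _ _ mYV).
transitivity (distribution P YV C) => //.
rewrite -(@product_measure_unique _ _ _ _ _ (distribution P Y') (distribution P V')
  (distribution P YV) _ C mC); last first.
  by move=> A1 A2 mA1 mA2; exact: indYV.
rewrite /product_measure1 /= ge0_integral_distribution //=.
- apply: eq_integral => w _ /=; rewrite /distribution /pushforward /=.
  by congr (P _); apply/seteqP; split => w'; rewrite /xsection /= inE.
- exact: measurable_fun_xsection.
Qed.

End joint_law.

Section sigma_gen.
Context {R : realType} {d : measure_display} {Om : measurableType d}.
Variables (I : set R) (Y : R -> Om -> R).

(** The generator of [sigma_gen], named so that [g_sigma_algebraType] can turn the sigma-algebra
    into a measurable type. *)
Definition sigma_gen_base : set (set Om) :=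
  [set A | exists t, I t /\ exists U : set R, measurable U /\ A = Y t @^-1` U].

Lemma measurable_sigma_gen t : I t ->
  measurable_fun setT (Y t : g_sigma_algebraType sigma_gen_base -> R).
Proof.
move=> It _ U mU; rewrite setTI; apply: sub_sigma_algebra.
by exists t; split => //; exists U.
Qed.

Lemma sub_sigma_gen A : (forall t, I t -> measurable_fun setT (Y t)) ->
  sigma_gen I Y A -> measurable A.
Proof.
move=> mY; apply: smallest_sub => /=; first exact: sigma_algebra_measurable.
by move=> _ [t [It [U [mU ->]]]]; rewrite -[X in measurable X]setTI; exact: mY.
Qed.

End sigma_gen.

Section brownian_law.
Context {R : realType} {d : measure_display} {Om : measurableType d}.
Variables (P : probability Om R) (B : R -> Om -> R).
Hypothesis hB : brownian_motion P B.

Definition increments (m : nat) (w : Om) : nat -> R :=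
  fun i => B (dyadic m i.+1) w - B (dyadic m i) w.

(** Induction on [k]: the first [k] increments are measurable for the past at time [dyadic m k], of
    which the next increment is independent. *)
Lemma prob_increments m k (U : nat -> set R) : (forall i, measurable (U i)) ->
  P [set w | forall i, (i < k)%N -> U i (increments m w i)] =
  (\prod_(i < k) normal_prob 0 (Num.sqrt (dyadic m i.+1 - dyadic m i)) (U i))%E.
Proof.
case: hB => mB _ _ lawB indB mU.
have dlt i : @dyadic R m i < dyadic m i.+1.
  by rewrite /dyadic ltr_pM2r ?invr_gt0 ?exprn_gt0 // ltr_nat.
elim: k => [|k IH].
  rewrite big_ord0 (_ : mkset _ = setT) ?probability_setT //.
  by apply/seteqP; split.
rewrite big_ord_recr /= -IH.
rewrite -lawB ?dyadic_ge0 // [RHS]muleC.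
rewrite -(indB _ _ (dyadic_ge0 m k) (dlt k) (U k)) //.
  congr (P _); apply/seteqP; split => w /=.
    by move=> H; split => [|i ik]; apply: H => //; exact: ltnW.
  by move=> [H1 H2] i; rewrite ltnS leq_eqVlt => /predU1P[->|/H2].
rewrite -/(sigma_gen_base _ _).
rewrite (_ : mkset _ = \bigcap_(i in [set i | (i < k)%N]) [set w | U i (increments m w i)]); last first.
  by apply/seteqP; split => w /= H i; exact: H.
suff : measurable ((\bigcap_(i in [set i | (i < k)%N]) [set w | U i (increments m w i)])
  : set (g_sigma_algebraType (sigma_gen_base `[0, dyadic m k] B))) by [].
(* The measurability of an intersection requires a nonempty index set. *)
have [->|k0] := eqVneq k 0%N.
  rewrite (_ : \bigcap_(i in _) _ = setT); last by apply/seteqP; split.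
  exact: (@measurableT _ (g_sigma_algebraType (sigma_gen_base `[0, dyadic m 0] B))).
apply: bigcap_measurable; first by exists 0%N; rewrite /= lt0n.
move=> i /= ik.
have mi : measurable_fun setT ((fun w => B (dyadic m i.+1) w - B (dyadic m i) w)
   : g_sigma_algebraType (sigma_gen_base `[0, dyadic m k] B) -> R).
  apply: measurable_funB; apply: measurable_sigma_gen;
  rewrite /= in_itv /= dyadic_ge0 /dyadic ler_pM2r ?invr_gt0 ?exprn_gt0 // ler_nat //.
  exact: ltnW.
rewrite -[X in measurable X]setTI; exact: mi.
Qed.

End brownian_law.

(** The cylinder sets with rectangular base, a pi-system that generates the product sigma-algebra on
    real sequences. *)
Definition boxes (R : realType) : set (set (nat -> R)) :=
  [set A | exists k (U : nat -> set R), (forall i, measurable (U i)) /\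
     A = [set v | forall i, (i < k)%N -> U i (v i)]].

Arguments boxes R : clear implicits.

Lemma boxes_setI (R : realType) : setI_closed (boxes R).
Proof.
move=> _ _ [k [U [mU ->]]] [l [V [mV ->]]].
exists (maxn k l), (fun i => [set x | ((i < k)%N -> U i x) /\ ((i < l)%N -> V i x)]).
split.
  move=> i; have mI (b : bool) (W : set R) : measurable W -> measurable [set x | b -> W x].
    case: b => mW.
      by rewrite (_ : mkset _ = W) //; apply/seteqP; split => x; [exact|move=> ? _].
    by rewrite (_ : mkset _ = setT) //; apply/seteqP; split.
  exact: (measurableI _ _ (mI _ _ (mU i)) (mI _ _ (mV i))).
apply/seteqP; split => v /=.
  by move=> [Hk Hl] i _; split; [exact: Hk|exact: Hl].
by move=> H; split => i il; have := H i; rewrite leq_max il ?orbT => /(_ isT) [? ?]; auto.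
Qed.

Section seq_law.
Context {R : realType} {d : measure_display} {Om : measurableType d}.
Variables (V : nat -> Om -> R).
Hypothesis mV : forall i, measurable_fun setT (V i).

Lemma measurable_seq :
  measurable_fun setT ((fun w => V ^~ w) : Om -> g_sigma_algebraType (boxes R)).
Proof.
apply: (@measurability _ _ Om (g_sigma_algebraType (boxes R)) setT _ (boxes R)) => //.
move=> _ [_ [k [U [mU ->]]] <-]; rewrite setTI.
have [->|k0] := eqVneq k 0%N.
  by rewrite (_ : _ @^-1` _ = setT) //; apply/seteqP; split.
rewrite (_ : _ @^-1` _ = \bigcap_(i in [set i | (i < k)%N]) (V i @^-1` (U i))); last first.
  by apply/seteqP; split => w H i; exact: H.
apply: bigcap_measurable; first by exists 0%N; rewrite /= lt0n.
by move=> i _; rewrite -[X in measurable X]setTI; exact: mV.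
Qed.

End seq_law.

(** Both laws are probability measures that agree on the generating pi-system [boxes], hence they
    are equal. *)
Lemma seq_law_unique {R : realType} d (Om : measurableType d) (P : probability Om R)
    (V : nat -> Om -> R) d' (Om' : measurableType d') (P' : probability Om' R)
    (V' : nat -> Om' -> R) :
  (forall i, measurable_fun setT (V i)) -> (forall i, measurable_fun setT (V' i)) ->
  (forall k (U : nat -> set R), (forall i, measurable (U i)) ->
    P [set w | forall i, (i < k)%N -> U i (V i w)] =
    P' [set w | forall i, (i < k)%N -> U i (V' i w)]) ->
  forall A : set (g_sigma_algebraType (boxes R)), measurable A ->
    P [set w | A (V ^~ w)] = P' [set w | A (V' ^~ w)].
Proof.
move=> mV mV' H A mA.
pose Y : {mfun Om >-> g_sigma_algebraType (boxes R)} :=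
  HB.pack ((fun w => V ^~ w) : Om -> g_sigma_algebraType (boxes R))
    (isMeasurableFun.Build _ _ _ _ _ (measurable_seq mV)).
pose Y' : {mfun Om' >-> g_sigma_algebraType (boxes R)} :=
  HB.pack ((fun w => V' ^~ w) : Om' -> g_sigma_algebraType (boxes R))
    (isMeasurableFun.Build _ _ _ _ _ (measurable_seq mV')).
have boxT : boxes R setT.
  by exists 0%N, (fun _ => setT); split => //; apply/seteqP; split.
change (distribution P Y A = distribution P' Y' A).
apply: (@measure_unique _ R (g_sigma_algebraType (boxes R)) (boxes R) (fun _ => setT)) => //.
- exact: boxes_setI.
- by rewrite bigcup_const.
- by move=> _ [k [U [mU ->]]]; exact: H.
- move=> _; apply: (@le_lt_trans _ _ 1%E); last exact: ltry.
  exact: (@probability_le1 _ _ _ (distribution P Y)).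
Qed.

Section brownian_dyadic_law.
Context {R : realType}.
Context {d : measure_display} {Om : measurableType d} {P : probability Om R}
  {B : R -> Om -> R}.
Context {d' : measure_display} {Om' : measurableType d'} {P' : probability Om' R}
  {B' : R -> Om' -> R}.
Hypothesis hB : brownian_motion P B.
Hypothesis hB' : brownian_motion P' B'.

Lemma measurable_increments e (T : measurableType e) (Q : probability T R)
    (C : R -> T -> R) m i :
  brownian_motion Q C -> measurable_fun setT (fun w => increments C m w i).
Proof.
by move=> [mC _ _ _ _]; apply: measurable_funB; apply: mC; exact: dyadic_ge0.
Qed.

Lemma sum_increments e (T : measurableType e) (Q : probability T R)
    (C : R -> T -> R) m j w :
  brownian_motion Q C -> \sum_(0 <= i < j) increments C m w i = C (dyadic m j) w.
Proof.
move=> [_ C0 _ _ _]; rewrite telescope_sumr //.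
by rewrite [in X in _ - X]/dyadic mul0r C0 subr0.
Qed.

Lemma brownian_grid_law m (J : set R) (a : R -> R) :
  P [set w | forall j, J (dyadic m j) -> a (dyadic m j) <= B (dyadic m j) w] =
  P' [set w | forall j, J (dyadic m j) -> a (dyadic m j) <= B' (dyadic m j) w].
Proof.
(* On one grid the values of [B] are partial sums of the increments, so the event depends only on
   the increment sequence. *)
pose A : set (g_sigma_algebraType (boxes R)) :=
  [set v | forall j, J (dyadic m j) -> a (dyadic m j) <= \sum_(0 <= i < j) v i].
have mA : measurable A.
  rewrite (_ : A = \bigcap_j [set v | J (dyadic m j) -> a (dyadic m j) <= \sum_(0 <= i < j) v i]);
    last by apply/seteqP; split => v H j; [move=> _|]; exact: H.
  apply: bigcapT_measurable => j.
  have [Jj|nJ] := pselect (J (dyadic m j)); last first.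
    by rewrite (_ : mkset _ = setT) //; apply/seteqP; split => v //= _ /nJ.
  have ms : measurable_fun setT (fun v : g_sigma_algebraType (boxes R) => \sum_(0 <= i < j) v i).
    apply: measurable_sum => i _ U mU; rewrite setTI; apply: sub_sigma_algebra.
    exists i.+1, (fun l => if l == i then U else setT); split.
      by move=> l; case: ifP.
    apply/seteqP; split => v /=; first by move=> Uv l _; case: eqP => [->|].
    by move=> /(_ i (ltnSn i)); rewrite eqxx.
  rewrite (_ : mkset _ = (fun v => \sum_(0 <= i < j) v i) @^-1` `[a (dyadic m j), +oo[).
    by rewrite -[X in measurable X]setTI; exact: ms.
  by apply/seteqP; split => v /=; rewrite in_itv /= andbT; [exact|move=> ? _].
have := @seq_law_unique R _ _ P (fun i w => increments B m w i) _ _ P'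
  (fun i w => increments B' m w i).
move=> /(_ _ _ _ A mA) H.
rewrite (_ : mkset _ = [set w | A (increments B m w)]); last first.
  apply/seteqP; split => w /= Hw j Jj; have := Hw j Jj; by rewrite (sum_increments _ _ _ hB).
rewrite [RHS](_ : _ = P' [set w | A (increments B' m w)]); last first.
  congr (P' _).
  apply/seteqP; split => w /= Hw j Jj; have := Hw j Jj; by rewrite (sum_increments _ _ _ hB').
apply: H => [i|i|k U mU].
- exact: (measurable_increments _ _ hB).
- exact: (measurable_increments _ _ hB').
- by rewrite (prob_increments hB) // (prob_increments hB').
Qed.

(** Since the grids are nested, the events on single grids decrease to the event on all dyadic
    times; their probabilities agree at each level, hence so do the limits. *)
Lemma brownian_dyadic_law (J : set R) (a : R -> R) : (forall u, J u -> 0 <= u) ->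
  prob P [set w | forall m j, J (dyadic m j) -> a (dyadic m j) <= B (dyadic m j) w] =
  prob P' [set w | forall m j, J (dyadic m j) -> a (dyadic m j) <= B' (dyadic m j) w].
Proof.
move=> J0.
have dyadicS m j : @dyadic R m.+1 (j * 2)%N = dyadic m j.
  by rewrite /dyadic natrM exprSr -mulf_div divff ?mulr1.
have cv e (T : measurableType e) (Q : probability T R) (C : R -> T -> R) :
  brownian_motion Q C ->
  prob Q [set w | forall j, J (dyadic m j) -> a (dyadic m j) <= C (dyadic m j) w]
    @[m --> \oo] -->
  prob Q [set w | forall m j, J (dyadic m j) -> a (dyadic m j) <= C (dyadic m j) w].
  move=> [mC _ _ _ _].
  pose F m := [set w | forall j, J (dyadic m j) -> a (dyadic m j) <= C (dyadic m j) w].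
  rewrite (_ : [set w | forall m j, _] = \bigcap_m F m); last first.
    by apply/seteqP; split => w H m; [move=> _|]; exact: H.
  apply: (@prob_cvg_bigcap _ _ _ Q F).
    move=> m.
    (* A single grid is written as a restriction of the time set [J], with zero initial condition,
       so that [measurable_dyadic_event] applies. *)
    rewrite (_ : F m = [set w | forall k j, (J `&` range (dyadic m)) (dyadic k j) ->
       a (dyadic k j) <= cst 0 w + C (dyadic k j) w]).
      apply: (@measurable_dyadic_event R _ _ (cst 0) C (J `&` range (dyadic m)) a) => //.
      by move=> u [/J0 u0 _]; exact: mC.
    apply/seteqP; split => w /= H.
      by move=> k j [+ [i _ E]]; rewrite -E add0r => Jk; exact: H.
    by move=> j Jj; rewrite -[leRHS]add0r; apply: H; split => //; exists j.
  apply/nonincreasing_seqP => m; apply/subsetPset => w /= H j Jj.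
  by have := H (j * 2)%N; rewrite dyadicS; apply.
have := cv _ _ _ _ hB; have := cv _ _ _ _ hB'.
rewrite (_ : (fun m => prob P _) = (fun m => prob P' [set w |
  forall j, J (dyadic m j) -> a (dyadic m j) <= B' (dyadic m j) w])); last first.
  by apply/funext => m; rewrite /prob brownian_grid_law.
move=> h1 h2; exact: (cvg_unique _ h2 h1).
Qed.

End brownian_dyadic_law.

(** * Lower semicontinuity of barrier events *)

(** Restricting to dyadic times keeps the event measurable; keeping [X0] apart from [B] allows
    conditioning on [X0], which replaces it by a constant. *)
Definition dyadic_event {R : realType} {T : Type} (X0 : T -> R) (B : R -> T -> R)
    (J : set R) (a : R -> R) : set T :=
  [set w | forall m j, J (dyadic m j) -> a (dyadic m j) <= X0 w + B (dyadic m j) w].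

Section dyadic_event_integral.
Context {R : realType} {d : measure_display} {Om : measurableType d}.
Variables (P : probability Om R) (X0 : Om -> R) (B : R -> Om -> R).
Hypothesis hdata : mv_data P X0 B.
Variables (J : set R) (a : R -> R).
Hypothesis J0 : forall u, J u -> 0 <= u.

Let mX0 : measurable_fun setT X0. Proof. by case: hdata. Qed.
Let mB (t : R) : J t -> measurable_fun setT (B t).
Proof. by move=> /J0; case: hdata => _ [+ _ _ _ _] _; apply. Qed.

Lemma measurable_mv_dyadic_event : measurable (dyadic_event X0 B J a).
Proof. exact: measurable_dyadic_event. Qed.

Let S := g_sigma_algebraType (sigma_gen_base `[0, +oo[ B).

Let mid : measurable_fun setT (id : Om -> S).
Proof.
move=> _ A mA; rewrite setTI; apply: (sub_sigma_gen (I := `[0, +oo[%classic) (Y := B)) => //.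
by move=> t; rewrite /= in_itv /= andbT; case: hdata => _ [+ _ _ _ _] _; apply.
Qed.

Let C : set (R * S) := dyadic_event (@fst R S) (fun u p => B u p.2) J a.

Let mC : measurable C.
Proof.
apply: measurable_dyadic_event; first exact: measurable_fst.
move=> u Ju.
have mBu : measurable_fun setT (B u : S -> R).
  by apply: measurable_sigma_gen; rewrite /= in_itv /= andbT; exact: J0.
exact: (measurableT_comp mBu (@measurable_snd _ _ R S)).
Qed.

Lemma measurable_dyadic_section :
  measurable_fun setT (fun x : R => P (dyadic_event (cst x) B J a)).
Proof. exact: (measurable_section_prob P mid mC). Qed.

Lemma dyadic_event_integral : P (dyadic_event X0 B J a) =
  (\int[P]_w P (dyadic_event (cst (X0 w)) B J a))%E.
Proof.
apply: (@indep_joint_law _ _ _ _ _ _ _ P X0 (id : Om -> S) mX0 mid _ C mC).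
by move=> A1 A2 mA1 mA2; case: hdata => _ _; apply.
Qed.

End dyadic_event_integral.

Section lipschitz_minorant.
Context {R : realType}.
Variable (G : R -> R).
Hypothesis Gmono : {homo G : x y / x <= y}.
Hypothesis G01 : forall x, 0 <= G x <= 1.

(** [f] is a sup-convolution of [G] with a one-sided cone of slope [delta^-1], shifted by [delta].
    The choice [y = x - delta] costs nothing, and any [y > x] costs at least 1, so it cannot lift
    [f x] above [G x]. The result is a continuous test function for weak convergence, although [G]
    may jump. *)
Lemma lipschitz_minorant (delta : R) : 0 < delta ->
  exists f : R -> R, [/\ continuous f, forall x, 0 <= f x <= 1,
    forall x, f x <= G x & forall x, G (x - delta) <= f x].
Proof.
move=> delta0.
have di0 : 0 <= delta^-1 by rewrite invr_ge0 ltW.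
have m0 (y : R) : 0 <= Num.max 0 y by rewrite le_max lexx.
pose S x := [set z | exists y, z = G y - delta^-1 * Num.max 0 (y - x + delta)].
have S1 x : ubound (S x) 1.
  move=> _ [y ->]; have /andP[_ h] := G01 y.
  have : 0 <= delta^-1 * Num.max 0 (y - x + delta).
    by rewrite mulr_ge0.
  lra.
have Sne x : S x !=set0 by exists (G x - delta^-1 * Num.max 0 (x - x + delta)), x.
have Sub x : has_ubound (S x) by exists 1; exact: S1.
pose f x := sup (S x).
have fge x : G (x - delta) <= f x.
  apply: ub_le_sup => //; exists (x - delta).
  by rewrite (_ : x - delta - x + delta = 0) ?maxxx ?mulr0 ?subr0 //; lra.
have fle x : f x <= G x.
  apply: ge_sup => // _ [y ->].
  have di : delta^-1 * delta = 1 by rewrite mulVf ?gt_eqF.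
  have [yx|xy] := leP y x.
    have : 0 <= delta^-1 * Num.max 0 (y - x + delta).
      by rewrite mulr_ge0.
    have := Gmono yx; lra.
  have : delta^-1 * delta <= delta^-1 * Num.max 0 (y - x + delta).
    by rewrite ler_wpM2l // le_max; apply/orP; right; lra.
  have := G01 x; have := G01 y; lra.
exists f; split => //.
- have lip x y : f x <= f y + delta^-1 * `|x - y|.
    apply: ge_sup => // _ [z ->].
    have : G z - delta^-1 * Num.max 0 (z - y + delta) <= f y.
      by apply: ub_le_sup => //; exists z.
    have : delta^-1 * Num.max 0 (z - y + delta) <=
           delta^-1 * (Num.max 0 (z - x + delta) + `|x - y|).
      rewrite ler_wpM2l // ge_max; apply/andP; split.
        by rewrite addr_ge0.
      have : z - x + delta <= Num.max 0 (z - x + delta) by rewrite le_max lexx orbT.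
      have := ler_norm (x - y); lra.
    rewrite mulrDr; lra.
  move=> x; apply/cvgrPdist_lt => e e0.
  have de0 : 0 < delta * e by rewrite mulr_gt0.
  exists (delta * e) => //= y /=; rewrite -ltr_pdivrMl // => xy.
  have h1 := lip x y; have h2 := lip y x; rewrite (distrC y x) in h2.
  by rewrite ltr_norml; apply/andP; split; lra.
- move=> x; have h1 := fge x; have h2 := fle x.
  by have := G01 x; have := G01 (x - delta); lra.
Qed.

End lipschitz_minorant.

(** Conditioning on the initial value turns the probabilities into means of a function [G], the same
    for all [n] because all Brownian motions have the same law. Raising the barrier by [delta]
    shifts the argument of [G] by [delta], and a continuous function between the two versions of [G]
    passes to the weak limit. *)
Lemma dyadic_event_liminf {R : realType} {d : measure_display}
  {Om : measurableType d} (P : probability Om R)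
  (X0 : Om -> R) (B : R -> Om -> R) (hdata : mv_data P X0 B)
  (d_ : nat -> measure_display) (Om_ : forall n, measurableType (d_ n))
  (P_ : forall n, probability (Om_ n) R)
  (X0_ : forall n, Om_ n -> R) (B_ : forall n, R -> Om_ n -> R)
  (hdata_ : forall n, mv_data (P_ n) (X0_ n) (B_ n))
  (hlaw : cvg_in_law P_ X0_ P X0) (J : set R) (a : R -> R) (delta e : R) :
  (forall u, J u -> 0 <= u) -> 0 < delta -> 0 < e ->
  exists N : nat, forall n, (N <= n)%N ->
    prob P (dyadic_event X0 B J (fun u => a u + delta)) - e
      < prob (P_ n) (dyadic_event (X0_ n) (B_ n) J a).
Proof.
move=> J0 delta0 e0.
have mE e' (T : measurableType e') (Q : probability T R) Y C b (h : mv_data Q Y C) :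
  measurable (dyadic_event Y C J b).
  exact: (measurable_mv_dyadic_event h).
have mEc e' (T : measurableType e') (Q : probability T R) Y C b x (h : mv_data Q Y C) :
  measurable (dyadic_event (cst x) C J b).
  apply: measurable_dyadic_event => // u /J0.
  by case: h => _ [+ _ _ _ _] _; apply.
pose G x := prob P (dyadic_event (cst x) B J a).
have GE n x : prob (P_ n) (dyadic_event (cst x) (B_ n) J a) = G x.
  rewrite /G; have [_ hB _] := hdata; have [_ hBn _] := hdata_ n.
  have := brownian_dyadic_law hB hBn (fun u => a u - x) J0.
  have E T (C : R -> T -> R) : dyadic_event (cst x) C J a =
    [set w | forall m j, J (dyadic m j) -> a (dyadic m j) - x <= C (dyadic m j) w].
    by apply/seteqP; split => w /= H m j Jj; have := H m j Jj; rewrite /= lerBlDl.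
  by rewrite !E => ->.
have Gmono : {homo G : x y / x <= y}.
  move=> x y xy; apply: prob_le; [exact: mEc hdata|exact: mEc hdata|].
  move=> w /= H m j Jj; apply: le_trans (H m j Jj) _ => /=; by rewrite lerD2r.
have G01 x : 0 <= G x <= 1.
  by rewrite prob_ge0 prob_le1 //; exact: mEc hdata.
have [f [cf f01 fG Gf]] := lipschitz_minorant Gmono G01 delta0.
have mf : measurable_fun setT f by exact: continuous_measurable_fun.
have fin_E e' (T : measurableType e') (Q : probability T R) Y :
  measurable_fun setT Y -> 'E_Q[f \o Y]%E \is a fin_num.
  move=> mY; rewrite unlock ge0_fin_numE; last first.
    by apply: integral_ge0 => w _; rewrite lee_fin; case/andP: (f01 (Y w)).
  apply: (@le_lt_trans _ _ (\int[Q]_w (cst 1%E w))%E); last first.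
    rewrite integral_cst // mul1e.
    by apply: (le_lt_trans (probability_le1 Q measurableT)); exact: ltry.
  apply: ge0_le_integral => //.
  - by move=> w _; rewrite lee_fin; case/andP: (f01 (Y w)).
  - by apply/measurable_EFinP; exact: measurableT_comp.
  - by move=> w _; rewrite lee_fin; case/andP: (f01 (Y w)).
have lower : ((prob P (dyadic_event X0 B J (fun u => (a u + delta)%R)))%:E <= 'E_P[f \o X0])%E.
  rewrite -probE; last exact: mE hdata.
  rewrite (dyadic_event_integral hdata) // unlock; apply: ge0_le_integral => //.
  - have [mX _ _] := hdata.
    exact: (measurableT_comp (measurable_dyadic_section hdata _ J0) mX).
  - by apply/measurable_EFinP; apply: measurableT_comp => //; case: hdata.
  - move=> w _; rewrite probE; last exact: mEc hdata.
    rewrite lee_fin; apply: le_trans (Gf _); apply: prob_le; [exact: mEc hdata..|].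
    by move=> w' /= H m j Jj; have := H m j Jj; rewrite /=; lra.
have upper n : ('E_(P_ n)[f \o X0_ n] <= (prob (P_ n) (dyadic_event (X0_ n) (B_ n) J a))%:E)%E.
  rewrite -probE; last exact: mE (hdata_ n).
  rewrite (dyadic_event_integral (hdata_ n)) // unlock; apply: ge0_le_integral => //.
  - by move=> w _; rewrite lee_fin; case/andP: (f01 (X0_ n w)).
  - by apply/measurable_EFinP; apply: measurableT_comp => //; case: (hdata_ n).
  - have [mX _ _] := hdata_ n.
    exact: (measurableT_comp (measurable_dyadic_section (hdata_ n) _ J0) mX).
  - move=> w _; rewrite probE; last exact: mEc (hdata_ n).
    by rewrite lee_fin GE; exact: fG.
have fb : exists K : R, forall x, `|f x| <= K.
  by exists 1 => x; rewrite ger0_norm; case/andP: (f01 x).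
have mX : measurable_fun setT X0 by case: hdata.
have := hlaw f cf fb; rewrite -(fineK (fin_E _ _ P X0 mX)) => /fine_cvgP [_].
move=> /cvgrPdist_lt /(_ e e0) [N _ HN]; exists N => n Nn.
have mXn : measurable_fun setT (X0_ n) by case: (hdata_ n).
have := HN n Nn; have := upper n; have := lower.
rewrite -(fineK (fin_E _ _ P X0 mX)) -(fineK (fin_E _ _ (P_ n) _ mXn)) !lee_fin /=.
by rewrite ltr_norml => h1 h2 /andP[h3 h4]; lra.
Qed.

(** * Gaussian estimates *)

Section gaussian.
Context {R : realType}.
Variable sigma : R.
Hypothesis sigma0 : sigma != 0.

Lemma normal_prob_sym (A : set R) : measurable A ->
  normal_prob 0 sigma A = normal_prob 0 sigma (-%R @^-1` A).
Proof.
move=> mA; rewrite /normal_prob.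
transitivity (\int[pushforward lebesgue_measure (-%R : _ -> measurableTypeR R)]_(x in A)
  (normal_pdf 0 sigma x)%:E)%E.
  by apply: eq_measure_integral => C mC _; exact/esym/lebesgue_measureN.
rewrite ge0_integral_pushforward //=.
- apply: eq_integral => x _ /=; congr (_%:E).
  by rewrite normal_pdfE // /normal_fun !subr0 sqrrN.
- by apply/measurable_EFinP; apply: measurable_funTS; exact: measurable_normal_pdf.
- by move=> x _; rewrite lee_fin normal_pdf_ge0.
Qed.

(** On [[x, x + 1]] the density is at least its value at [x + 1]. *)
Lemma normal_prob_tail_gt0 (x : R) : 0 <= x -> (0 < normal_prob 0 sigma `[x, +oo[)%E.
Proof.
move=> x0; pose c := normal_pdf 0 sigma (x + 1).
have c0 : 0 < c.
  by rewrite /c normal_pdfE // mulr_gt0 ?normal_peak_gt0 ?expR_gt0.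
apply: (@lt_le_trans _ _ (normal_prob 0 sigma `[x, x + 1])); last first.
  apply: le_measure; rewrite ?inE //.
  by apply: subset_itvl; rewrite bnd_simp.
apply: (@lt_le_trans _ _ c%:E) => //.
have -> : (c%:E = \int[lebesgue_measure]_(y in `[x, (x + 1)%R]) (cst c%:E y))%E.
  rewrite integral_cst //= lebesgue_measure_itv /= lte_fin ltrDl ltr01.
  by rewrite -EFinB addrAC subrr add0r mule1.
apply: ge0_le_integral => //.
- by move=> y _; rewrite lee_fin ltW.
- by apply/measurable_EFinP; apply: measurable_funTS; exact: measurable_normal_pdf.
- move=> y /=; rewrite in_itv /= => /andP[xy yx].
  rewrite lee_fin /c normal_pdfE // ler_wpM2l ?normal_peak_ge0 //.
  rewrite ler_expR !mulNr lerN2 !subr0 ler_wpM2r //.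
    by rewrite invr_ge0 mulrn_wge0 // sqr_ge0.
  by rewrite lerXn2r ?nnegrE // ?addr_ge0 //; exact: le_trans xy.
Qed.

Lemma normal_prob_set1 (x : R) : normal_prob 0 sigma [set x] = 0%E.
Proof. exact: integral_set1. Qed.

(** For [e >= 0] this is the projection onto [[0, e]]. It serves as a lower bound for [alpha] times
    the surviving mass at or below a level. *)
Definition clamp (e x : R) := Num.min e (Num.max 0 x).

Lemma clamp_ge0 e x : 0 <= e -> 0 <= clamp e x.
Proof. by move=> e0; rewrite /clamp le_min e0 le_max lexx. Qed.

(** The two arguments add up to [2 * delta]. Clipping at 0 only raises the sum, and a term clipped
    at [e] alone already exceeds [2 * delta]; for [n >= e] such a term is present. *)
Lemma clamp_sum (delta e n : R) : 0 <= delta -> 2 * delta < e ->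
  2 * delta + (e - 2 * delta) * (e <= n)%R%:R <= clamp e (delta - n) + clamp e (delta + n).
Proof.
move=> d0 de; have e0 : 0 <= e by lra.
have cx x : x <= e -> x <= clamp e x by move=> xe; rewrite /clamp le_min xe le_max lexx orbT.
have ce x : e <= x -> e <= clamp e x.
  by move=> xe; rewrite /clamp le_min lexx le_max xe orbT.
have c2 x : 2 * delta <= x -> 2 * delta <= clamp e x.
  by move=> xe; rewrite /clamp le_min ltW //= le_max xe orbT.
have h1 := @clamp_ge0 e (delta - n) e0; have h2 := @clamp_ge0 e (delta + n) e0.
have [en|ne] := leP e n; first by rewrite mulr1; have := ce (delta + n) ltac:(lra); lra.
rewrite mulr0 addr0; have [nd|dn] := leP n (- delta).
  by have := c2 (delta - n) ltac:(lra); lra.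
have [nd|nd] := leP delta n; first by have := c2 (delta + n) ltac:(lra); lra.
have := cx (delta - n) ltac:(lra); have := cx (delta + n) ltac:(lra); lra.
Qed.

Lemma measurable_clamp e : measurable_fun setT (clamp e).
Proof.
by apply: measurable_minr => //; exact: measurable_maxr.
Qed.

(* By symmetry the mean of clamp e (delta - n) is half that of the sum in
   clamp_sum. *)
Lemma lt_clamp_mean (delta e : R) : 0 <= delta -> 2 * delta < e ->
  (delta%:E < \int[normal_prob 0 sigma]_n (clamp e (delta - n))%:E)%E.
Proof.
move=> delta0 de; have e0 : 0 <= e by lra.
set I := (\int[_]_n _)%E.
have mfm : measurable_fun setT (fun n : R => clamp e (delta - n)).
  by apply: (measurableT_comp (measurable_clamp e)); exact: measurable_funB.
have mfp : measurable_fun setT (fun n : R => clamp e (delta + n)).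
  by apply: (measurableT_comp (measurable_clamp e)); exact: measurable_funD.
have IN : I = (\int[normal_prob 0 sigma]_n (clamp e (delta + n))%:E)%E.
  transitivity (\int[pushforward (normal_prob 0 sigma) (-%R : _ -> measurableTypeR R)]_n
    (clamp e (delta - n))%:E)%E.
    by apply: eq_measure_integral => A mA _; exact: normal_prob_sym.
  rewrite ge0_integral_pushforward //=.
  - by apply: eq_integral => x _ /=; rewrite opprK.
  - exact/measurable_EFinP.
  - by move=> y _; rewrite lee_fin clamp_ge0.
have I0 : (0 <= I)%E by apply: integral_ge0 => n _; rewrite lee_fin clamp_ge0.
(* Integration of [clamp_sum]; the tail beyond [e] has positive probability, which makes the final
   inequality strict. *)
have key : ((2 * delta)%:E + (e - 2 * delta)%:E * normal_prob 0 sigma `[e, +oo[ <= I + I)%E.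
  rewrite {2}IN -ge0_integralD //; first last.
  - exact/measurable_EFinP.
  - by move=> n _; rewrite lee_fin clamp_ge0.
  - exact/measurable_EFinP.
  - by move=> n _; rewrite lee_fin clamp_ge0.
  have -> : ((2 * delta)%:E + (e - 2 * delta)%:E * normal_prob 0 sigma `[e, +oo[ =
    \int[normal_prob 0 sigma]_n ((2 * delta)%:E + (e - 2 * delta)%:E * (\1_`[e, +oo[ n)%:E))%E.
    rewrite ge0_integralD //.
    - rewrite integral_cst // ge0_integralZl_EFin //.
      + rewrite integral_indic // setIT; congr (_ + _)%E.
        rewrite -[LHS]mule1; congr (_ * _)%E.
        exact/esym/(probability_setT
          (normal_prob 0 sigma : probability (measurableTypeR R) R)).
      + by apply/measurable_EFinP; exact: measurable_indic.
      + by lra.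
    - by move=> n _; rewrite lee_fin; lra.
    - by move=> n _; rewrite -EFinM lee_fin mulr_ge0 //; lra.
    - by apply/measurable_EFinP; apply: measurable_funM => //; exact: measurable_indic.
  apply: ge0_le_integral => //.
  - move=> n _; rewrite -EFinM -EFinD lee_fin addr_ge0 ?mulr_ge0 //; lra.
  - apply/measurable_EFinP; apply: measurable_funD => //.
    by apply: measurable_funM => //; exact: measurable_indic.
  - by apply: emeasurable_funD; exact/measurable_EFinP.
  - move=> n _; rewrite -EFinM -!EFinD lee_fin indicE mem_setE in_itv /= andbT.
    exact: clamp_sum.
have tail := normal_prob_tail_gt0 e0.
rewrite ltNge; apply/negP => Id.
have : (I + I <= (2 * delta)%:E)%E.
  by rewrite mulr_natl mulr2n EFinD leeD.
move=> /(le_trans key); rewrite leNgt => /negP; apply.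
rewrite -[ltLHS]adde0 lteD2lE // mule_gt0 // lte_fin; lra.
Qed.

End gaussian.

(** * Lower bound on the jump *)

Section past.
Context {R : realType} {d : measure_display} {Om : measurableType d}.
Variables (P : probability Om R) (X0 : Om -> R) (B : R -> Om -> R).
Hypothesis hdata : mv_data P X0 B.
Variables (t h : R).
Hypotheses (t0 : 0 <= t) (h0 : 0 < h).

Let mX0 : measurable_fun setT X0. Proof. by case: hdata. Qed.
Let mB (s : R) : 0 <= s -> measurable_fun setT (B s).
Proof. by case: hdata => _ [+ _ _ _ _] _; apply. Qed.

(* The sigma-algebra of X0 and B on [0, t], by a generating pi-system. *)
Definition past_base : set (set Om) :=
  [set C | exists V A, [/\ measurable V, sigma_gen `[0, t] B A & C = X0 @^-1` V `&` A]].

Let sigma_gen_measurable A : sigma_gen `[0, t] B A -> measurable A.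
Proof. by apply: sub_sigma_gen => s; rewrite /= in_itv /= => /andP[/mB]. Qed.

Let past_base_measurable C : past_base C -> measurable C.
Proof.
move=> [V [A [mV /sigma_gen_measurable mA ->]]]; apply: measurableI => //.
by rewrite -[X in measurable X]setTI; exact: mX0.
Qed.

Let S := g_sigma_algebraType past_base.

Lemma measurable_past_id : measurable_fun setT (id : Om -> S).
Proof.
move=> _ C; rewrite setTI; apply: smallest_sub; first exact: sigma_algebra_measurable.
exact: past_base_measurable.
Qed.

Lemma measurable_past_X0 : measurable_fun setT (X0 : S -> R).
Proof.
move=> _ V mV; rewrite setTI; apply: sub_sigma_algebra.
exists V, setT; split => //; last by rewrite setIT.
exact: (@measurableT _ (g_sigma_algebraType (sigma_gen_base `[0, t] B))).
Qed.

Lemma measurable_past_B (s : R) : 0 <= s <= t -> measurable_fun setT (B s : S -> R).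
Proof.
move=> st _ V mV; rewrite setTI; apply: sub_sigma_algebra.
exists setT, (B s @^-1` V); split => //; last by rewrite preimage_setT setTI.
by apply: sub_sigma_algebra; exists s; split; [rewrite /= in_itv|exists V].
Qed.

(** For fixed [U] both sides are finite measures in [C], so they need to be compared only on
    [past_base]. There [X0] is split off first, being independent of all of [B], and then the
    increment is split from the past of [B]. *)
Lemma increment_indep_past (U : set R) (C : set S) : measurable U -> measurable C ->
  P ((fun w => B (t + h) w - B t w) @^-1` U `&` C) =
  (P ((fun w => B (t + h) w - B t w)%R @^-1` U) * P C)%E.
Proof.
move=> mU mC; set NU := _ @^-1` U.
have th : t < t + h by rewrite ltrDl.
have mNU : measurable NU.
  have mN : measurable_fun setT (fun w => B (t + h) w - B t w).
    by apply: measurable_funB; apply: mB => //; rewrite addr_ge0 // ltW.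
  by rewrite -[X in measurable X]setTI; exact: mN.
pose i : {mfun Om >-> S} := HB.pack (id : Om -> S) (isMeasurableFun.Build _ _ _ _ _ measurable_past_id).
pose p : {nonneg R} := NngNum (prob_ge0 P NU).
have Pp : P NU = p%:num%:E by rewrite probE.
rewrite Pp setIC.
change (pushforward (mrestr P mNU) i C = mscale p (distribution P i) C).
have sg_mono : sigma_gen `[0, t] B `<=` sigma_gen `[0, +oo[ B.
  apply: sub_sigma_algebra2 => A' [s [st Hs]]; exists s; split => //.
  by move: st; rewrite /= !in_itv /= andbT => /andP[].
have pastT : past_base setT.
  exists setT, setT; split => //; last by rewrite preimage_setT setTI.
  exact: (@measurableT _ (g_sigma_algebraType (sigma_gen_base `[0, t] B))).
apply: (@measure_unique _ R S past_base (fun _ => setT)) => //.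
- move=> _ _ [V1 [A1 [mV1 mA1 ->]]] [V2 [A2 [mV2 mA2 ->]]].
  exists (V1 `&` V2), (A1 `&` A2); split; first exact: measurableI.
    exact: (@measurableI _ (g_sigma_algebraType (sigma_gen_base `[0, t] B))).
  by rewrite preimage_setI setIACA.
- by rewrite bigcup_const.
- move=> _ [V [A [mV mA ->]]]; 
  change (P (X0 @^-1` V `&` A `&` NU) = (p%:num%:E * P (X0 @^-1` V `&` A))%E).
  rewrite -Pp /NU.
  case: hdata => _ [_ _ _ _ indB] indX.
  have mV' := mV; have mA' := mA.
  rewrite -setIA indX //; last first.
    apply: (@measurableI _ (g_sigma_algebraType (sigma_gen_base `[0, +oo[ B))).
      exact: sg_mono.
    have mi : measurable_fun setT ((fun w => B (t + h) w - B t w)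
      : g_sigma_algebraType (sigma_gen_base `[0, +oo[ B) -> R).
      by apply: measurable_funB; apply: measurable_sigma_gen; rewrite /= in_itv /= andbT // addr_ge0 // ltW.
    by rewrite -[X in measurable X]setTI; exact: mi.
  rewrite setIC indB // indX //; last exact: sg_mono.
  by rewrite muleCA.
- move=> _; rewrite /pushforward /mrestr /=.
  apply: (@le_lt_trans _ _ 1%E); last exact: ltry.
  by apply: probability_le1; rewrite setTI.
Qed.

End past.

Section jump_lower_bound.
Context {R : realType} {d : measure_display} {Om : measurableType d}.
Variables (P : probability Om R) (alpha : R) (X0 : Om -> R) (B : R -> Om -> R).
Variable L : R -> R.
Hypothesis halpha : 0 < alpha.
Hypothesis hdata : mv_data P X0 B.
Hypothesis hsol : mv_solution P alpha X0 B L.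

Let ML : M L. Proof. by case: hsol. Qed.
Let mX0 : measurable_fun setT X0. Proof. by case: hdata. Qed.
Let mB (t : R) : 0 <= t -> measurable_fun setT (B t).
Proof. by case: hdata => _ [+ _ _ _ _] _; apply. Qed.
Let B0 w : B 0 w = 0. Proof. by case: hdata => _ [_ + _ _ _] _; apply. Qed.
Let cB w : {within `[0, +oo[, continuous (fun t => B t w)}.
Proof. by case: hdata => _ [_ _ + _ _] _; apply. Qed.

(** With [N] the increment of [B] and [delta] that of [L], a path that survives [t] with state at
    most [delta - N] has a state at most 0 at [t + h], so it is absorbed meanwhile. Since [N] is
    independent of the past, the mass of these paths is a mean over [N], bounded below through
    [g]. *)
Lemma increment_ge_mean (t h : R) (g : R -> R) : 0 <= t -> 0 < h ->
  measurable_fun setT g -> (forall y, 0 <= g y) ->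
  (forall y, g y <= alpha *
     prob P [set w | (t%:E < tau X0 B L w)%E /\ X0 w + B t w - L t <= y]) ->
  (\int[P]_w (g (L (t + h) - L t - (B (t + h) w - B t w)))%:E
   <= (L (t + h) - L t)%:E)%E.
Proof.
move=> t0 h0 mg g0 gle; set delta := L (t + h) - L t.
have th0 : 0 <= t + h by lra.
pose N w := B (t + h) w - B t w.
pose S := g_sigma_algebraType (past_base X0 B t).
have mN : measurable_fun setT N by apply: measurable_funB; apply: mB => //; lra.
pose Q : set (R * S) :=
  [set p | (t%:E < tau X0 B L p.2)%E /\ X0 p.2 + B t p.2 - L t <= delta - p.1].
have mXS : measurable_fun setT (X0 : S -> R) by exact: measurable_past_X0.
have mBS (s : R) : 0 <= s <= t -> measurable_fun setT (B s : S -> R).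
  exact: measurable_past_B.
have mid : measurable_fun setT (id : Om -> S) by exact: (measurable_past_id hdata).
have mQ : measurable Q.
  apply: (@measurableI _ (R * S)%type).
    have mt : measurable [set w : S | (t%:E < tau X0 B L w)%E].
      by apply: measurable_lt_tau => // w; exact: cB.
    rewrite -[X in measurable X]setTI.
    exact: (@measurable_snd _ _ R S measurableT _ mt).
  have mf : measurable_fun setT (fun p : R * S => X0 p.2 + B t p.2 + p.1).
    apply: measurable_funD; last exact: measurable_fst.
    apply: measurable_funD.
      exact: (measurableT_comp mXS (@measurable_snd _ _ R S)).
    by apply: (measurableT_comp (mBS t _) (@measurable_snd _ _ R S)); rewrite t0 lexx.
  rewrite [X in measurable X](_ : _ = (fun p : R * S => X0 p.2 + B t p.2 + p.1) @^-1` `]-oo, delta + L t]).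
    by rewrite -[X in measurable X]setTI; exact: mf.
  by apply/seteqP; split => p; rewrite /= in_itv /=; lra.
have joint := indep_joint_law mN mid
  (increment_indep_past hdata t0 h0) mQ.
have msec := measurable_section_prob P mid mQ.
have mgt := measurable_gt_tau hdata hsol t0.
have mgth := measurable_gt_tau hdata hsol th0.
have mA y : measurable [set w | (t%:E < tau X0 B L w)%E /\ X0 w + B t w - L t <= y].
  apply: measurableI => //.
  rewrite [X in measurable X](_ : _ = [set w | `]-oo, y]%classic (X0 w + B t w - L t)]).
    exact: (measurable_state hdata).
  by apply/seteqP; split => w; rewrite /= in_itv.
apply: (@le_trans _ _ (\int[P]_w (alpha%:E * P [set w' | Q (N w, w')]))%E).
  apply: ge0_le_integral => //.
  - by move=> w _; rewrite lee_fin.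
  - apply/measurable_EFinP; apply: (measurableT_comp mg).
    exact: measurable_funB.
  - apply: measurable_funeM; exact: (measurableT_comp msec mN).
  - by move=> w _; rewrite probE; [rewrite -EFinM lee_fin; exact: gle|exact: (mA (delta - N w))].
rewrite ge0_integralZl_EFin //; first last.
- exact: ltW.
- exact: (measurableT_comp msec mN).
rewrite -joint.
have mE : measurable [set w | Q (N w, w)].
  have m2 : measurable_fun setT (fun w => (N w, w) : R * S).
    by apply: measurable_fun_pair.
  by rewrite -[X in measurable X]setTI; exact: m2.
rewrite probE // -EFinM lee_fin /delta (solution_gt hdata hsol t0).
rewrite (solution_gt hdata hsol th0).
have sub : [set w | ((t + h)%:E < tau X0 B L w)%E] `<=` [set w | (t%:E < tau X0 B L w)%E].
  by move=> w /=; apply: lt_trans; rewrite lte_fin ltrDl.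
have : prob P [set w | Q (N w, w)] <=
  prob P ([set w | (t%:E < tau X0 B L w)%E] `\` [set w | ((t + h)%:E < tau X0 B L w)%E]).
  apply: prob_le => //; first exact: measurableD.
  move=> w [/= tw Xw]; split => // /(lt_tauP _ cB ML _ th0) /(_ (t + h) th0 (lexx _)).
  by move: Xw; rewrite /N /delta; lra.
rewrite prob_setD // => /(ler_wpM2l (ltW halpha)); lra.
Qed.

Lemma jump_ge_inf (t : R) : 0 <= t ->
  inf [set x : R | 0 < x /\
    (alpha%:E * P [set w | (t%:E <= tau X0 B L w)%E /\
                           (0 < left_limit (mvX X0 B L w) t <= x)%R] < x%:E)%E]
  <= L t - left_limit L t.
Proof.
move=> t0; set Sx := [set x | _].
rewrite leNgt; apply/negP => jlt.
(* Half of the gap, so that the jump plus any [y <= e] stays below the infimum and hence outside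
   [Sx]. *)
pose e := (inf Sx - (L t - left_limit L t)) / 2.
have e0 : 0 < e by rewrite /e; lra.
have j0 : 0 <= L t - left_limit L t by rewrite subr_ge0; exact: left_limit_le_self.
have mge := measurable_ge_tau hdata hsol t0.
have mgt := measurable_gt_tau hdata hsol t0.
have mX y : measurable [set w | X0 w + B t w - L t <= y].
  rewrite [X in measurable X](_ : _ = [set w | `]-oo, y]%classic (X0 w + B t w - L t)]).
    exact: (measurable_state hdata).
  by apply/seteqP; split => w; rewrite /= in_itv.
pose A y := [set w | (t%:E < tau X0 B L w)%E /\ X0 w + B t w - L t <= y].
have mA y : measurable (A y) by exact: (measurableI _ _ mgt (mX y)).
(* Paths with left state in [(0, x]] carry [alpha]-mass at least [x]. Those absorbed at [t] carry at
   most the jump of [L]; the others have state at most [y] after the jump. *)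
have Sin y : 0 < y -> y <= e -> y <= alpha * prob P (A y).
  move=> y0 ye; pose x := L t - left_limit L t + y.
  have x0 : 0 < x by rewrite /x; lra.
  have : ~ Sx x.
    move=> Sxx; have : inf Sx <= x by apply: ge_inf => //; exists 0 => z [/ltW].
    rewrite /x; move: ye; rewrite /e; lra.
  move=> /not_andP[/(_ x0)//|/negP]; rewrite -leNgt probE; last exact: (measurable_jump_event hdata hsol).
  rewrite -EFinM lee_fin => H.
  have : prob P [set w | (t%:E <= tau X0 B L w)%E /\ 0 < left_limit (mvX X0 B L w) t <= x]
    <= prob P (([set w | (t%:E <= tau X0 B L w)%E] `\` [set w | (t%:E < tau X0 B L w)%E])
       `|` A y).
    apply: prob_le; [exact: (measurable_jump_event hdata hsol)
      |by apply: measurableU => //; exact: measurableD|].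
    move=> w [/= tw]; rewrite (left_limit_mvX _ B0 cB ML) // => /andP[_ Xw].
    have [tt|tt] := pselect (t%:E < tau X0 B L w)%E; last by left.
    by right; split => //; move: Xw; rewrite /x; lra.
  move=> /le_trans /(_ (prob_setU_le _ (measurableD mge mgt) (mA y))).
  rewrite prob_setD //; last by move=> w /=; exact: ltW.
  move=> /(ler_wpM2l (ltW halpha)); have := solution_ge halpha hdata hsol t0.
  have := solution_gt hdata hsol t0; move: H; rewrite /x; lra.
have clampA y : clamp e y <= alpha * prob P (A y).
  have a0 : 0 <= alpha * prob P (A y) by rewrite mulr_ge0 ?prob_ge0 // ltW.
  have [y0|y0] := leP y 0.
    by rewrite /clamp (max_idPl y0) (min_idPr (ltW e0)).
  rewrite /clamp (max_idPr (ltW y0)); have [ye|ye] := leP e y; last first.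
    by apply: Sin => //; exact: ltW.
  apply: (le_trans (Sin e e0 (lexx _))); rewrite ler_pM2l //.
  by apply: prob_le => // w [/= ? Xw]; split => //; exact: le_trans ye.
have e20 : 0 < e / 2 by lra.
(* The bound [e / 2] on the increment [delta] gives the condition [2 * delta < e] of
   [lt_clamp_mean]. The contradiction is that [delta] is smaller than a mean that is itself at most
   [delta]. *)
have [h h0 Hh] := M_right ML t e20.
have h20 : 0 < h / 2 by lra.
have := Hh (t + h / 2) ltac:(lra).
have := increment_ge_mean t0 h20 (measurable_clamp e) _ clampA.
set delta := L (t + h / 2) - L t => /(_ (fun y => clamp_ge0 y (ltW e0))) upper hdelta.
have delta0 : 0 <= delta.
  by rewrite subr_ge0; case: ML => _ _; apply; lra.
have mN : measurable_fun setT (fun w => B (t + h / 2) w - B t w).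
  by apply: measurable_funB; apply: mB => //; lra.
have sg0 : Num.sqrt (t + h / 2 - t) != 0 by rewrite gt_eqF // sqrtr_gt0; lra.
have := @lt_clamp_mean R _ sg0 delta e delta0 ltac:(rewrite /delta; lra).
rewrite ltNge => /negP; apply; apply: le_trans upper.
case: hdata => _ [_ _ _ lawB _] _.
rewrite -(@ge0_integral_pushforward _ _ _ (measurableTypeR R) _ _ mN P setT
  (fun n => (clamp e (delta - n))%:E)) //.
- rewrite le_eqVlt; apply/predU1P; left; apply: eq_measure_integral => C mC _.
  have tt : t < t + h / 2 by lra.
  by have := lawB _ _ t0 tt C mC.
- by apply/measurable_EFinP; apply: (measurableT_comp (measurable_clamp e)); exact: measurable_funB.
- by move=> n _; rewrite lee_fin clamp_ge0 // ltW.
Qed.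

End jump_lower_bound.

(** * Upper bound on the jump *)

Section paths.
Context {R : realType} {T : Type}.
Variables (X0 : T -> R) (B : R -> T -> R) (L : R -> R).
Hypothesis cB : forall w, {within `[0, +oo[, continuous (fun t => B t w)}.
Hypothesis ML : M L.

Lemma path_unif_cont w (t e : R) : 0 < e -> exists2 h : R, 0 < h &
  forall u v : R, 0 <= u -> u <= t -> 0 <= v -> `|v - u| < h -> `|B v w - B u w| < e.
Proof.
move=> e0.
have /compact_near_coveringP/near_covering_withinP := @segment_compact R 0 t.
move=> /(_ nat \oo (fun k u => forall v : R, 0 <= v -> `|v - u| < k.+1%:R^-1 ->
  `|B v w - B u w| < e)).
case.
  move=> u /=; rewrite in_itv /= => /andP[u0 ut].
  have e20 : 0 < e / 2 by lra.
  have [h h0 Hh] := path_cont cB w u0 e20.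
  have h20 : 0 < h / 2 by lra.
  have [k Hk] := natSinv_lt h20.
  exists ([set v | `|v - u| < h / 2], [set n | (k <= n)%N]) => /=.
    split; last by exists k.
    by exists (h / 2) => //= v; rewrite /= distrC.
  move=> [v n] /= [vu kn]; rewrite in_itv /= => /andP[v0 vt] z z0 zv.
  have zh := lt_trans zv (Hk n kn).
  have h1 : `|v - u| < h by lra.
  have h2 : `|z - u| < h by move: vu zh; rewrite !ltr_norml; lra.
  have := Hh v v0 h1; have := Hh z z0 h2; rewrite !ltr_norml; lra.
move=> k _ /(_ k (leqnn k)) Hk; exists k.+1%:R^-1; first by rewrite invr_gt0.
by move=> u v u0 ut v0; apply: Hk => //=; rewrite in_itv /= u0.
Qed.

(** The bound reaches an arbitrary time [u] through dyadic times decreasing to it, by continuity of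
    the path. *)
Lemma dyadic_event_dense w J a (u b c : R) : dyadic_event X0 B J a w ->
  0 <= u -> u < b -> (forall v : R, u < v -> v < b -> J v /\ c <= a v) ->
  c <= X0 w + B u w.
Proof.
move=> Ew u0 ub Ja; rewrite leNgt; apply/negP => lt_c.
have e0 : 0 < c - (X0 w + B u w) by lra.
have [h h0 Hh] := path_cont cB w u0 e0.
have uh : u < Num.min (u + h) b by rewrite lt_min ub ltrDl h0.
have [m [j /andP[uv]]] := dyadic_dense u0 uh.
rewrite lt_min => /andP[vh vb].
have [Jv cv] := Ja _ uv vb; have := Ew m j Jv.
have vu : `|dyadic m j - u| < h by rewrite ltr_norml; lra.
have := Hh _ (dyadic_ge0 m j) vu; rewrite ltr_norml; lra.
Qed.

Lemma left_state_ge0 w (t : R) : 0 < t -> (t%:E <= tau X0 B L w)%E ->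
  0 <= X0 w + B t w - left_limit L t.
Proof.
move=> t0 /le_tauP Hw; rewrite leNgt; apply/negP => neg.
pose e := - (X0 w + B t w - left_limit L t) / 2.
have e0 : 0 < e by rewrite /e; lra.
have [h h0 Hh] := path_cont cB w (ltW t0) e0.
have [v vt Lv] := left_limit_near ML t e0.
(* A time in [[0, t[] at which [L] is almost its left limit at [t] and [B] is almost [B t]. *)
pose u := Num.max 0 (Num.max v (t - h / 2)).
have u0 : 0 <= u by rewrite /u le_max lexx.
have ut : u < t by rewrite /u !gt_max t0 vt /=; lra.
have vu : v <= u by rewrite /u !le_max lexx !orbT.
have tu : t - h / 2 <= u by rewrite /u !le_max lexx !orbT.
have uth : `|u - t| < h by rewrite ltr_norml; lra.
have := Hh u u0 uth; have := Hw u u0 ut.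
have : L v <= L u by case: ML => _ _; apply.
rewrite ltr_norml; move: Lv; rewrite /e; lra.
Qed.

(* The grid levels dominate those of the approximating solutions up to the
   time shift that M1 convergence forces. *)
Definition barrier (t x rho u : R) : R :=
  if u < Num.max 0 (t - 2 * rho) then L (u + rho) + 2 * rho
  else left_limit L t + x + 2 * rho.

(** The window of length [5 * rho] after [Num.max 0 (t - 2 * rho)] reaches past [t + 2 * rho], a
    time at which M1 closeness bounds [L_ n] from below by [L t - rho]. *)
Definition barrier_domain (t rho : R) : set R :=
  [set u | 0 <= u /\ u < Num.max 0 (t - 2 * rho) + 5 * rho].

(** Before [t] the state has a positive lower bound, so uniform continuity of the path pays for the
    time shift by [rho]; around [t] the path stays close to [B t], and the left state exceeds [x]
    strictly. *)
Lemma above_barrier w (t x : R) : 0 <= t -> 0 < x ->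
  (t%:E <= tau X0 B L w)%E -> x < X0 w + B t w - left_limit L t ->
  \forall k \near \oo, dyadic_event X0 B (barrier_domain t k.+1%:R^-1)
    (fun u => barrier t x k.+1%:R^-1 u + k.+1%:R^-1) w.
Proof.
move=> t0 x0 /le_tauP Hw Xt.
pose mu := X0 w + B t w - left_limit L t - x.
have mu0 : 0 < mu by rewrite /mu; lra.
have mu20 : 0 < mu / 2 by lra.
have [eta eta0 Heta] := path_cont cB w t0 mu20.
(* Away from [t] this is [state_bounded_away]; near [t] the state exceeds [x]. *)
have [m m0 Hm] : exists2 m : R, 0 < m & forall u : R, 0 <= u -> u < t ->
    m <= X0 w + B u w - L u.
  have [k Hk] : exists k : nat, forall u : R, 0 <= u -> u <= t - eta / 2 ->
      k.+1%:R^-1 <= X0 w + B u w - L u.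
    by apply: (state_bounded_away cB ML) => u u0 ut; apply: Hw => //; lra.
  exists (Num.min x k.+1%:R^-1); first by rewrite lt_min x0 invr_gt0 ltr0Sn.
  move=> u u0 ut; rewrite ge_min; have [ute|ute] := leP u (t - eta / 2).
    by rewrite (Hk u u0 ute) orbT.
  have ute' : `|u - t| < eta by rewrite ltr_norml; lra.
  have := Heta u u0 ute'; have := left_limit_ge ML ut.
  rewrite ltr_norml /mu => h1 h2; apply/orP; left; lra.
have m20 : 0 < m / 2 by lra.
have [xi xi0 Hxi] := path_unif_cont w t m20.
(* The window stays within [5 * rho] of [t], and the surplus [3 * rho] of the raised barrier must
   fit into the margins [mu / 2] and [m / 2]. *)
pose r0 := Num.min (Num.min (eta / 5) (mu / 6)) (Num.min xi (m / 6)).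
have r00 : 0 < r0 by rewrite /r0 !lt_min xi0 /=; apply/andP; split; [apply/andP; split|]; lra.
have [k0 Hk0] := natSinv_lt r00.
exists k0 => // k /= kk0; have rk := Hk0 k kk0.
have rho0 : 0 < k.+1%:R^-1 :> R by rewrite invr_gt0.
move: (k.+1%:R^-1) rho0 rk => rho rho0.
rewrite /r0 !lt_min => /andP[/andP[r1 r2] /andP[r3 r4]] i j.
move: (dyadic i j) => u [u0 us]; rewrite /barrier; case: ifPn.
  rewrite lt_max => /orP[|ut]; first by lra.
  have ur0 : 0 <= u + rho by lra.
  have urt : u + rho < t by lra.
  have uu : `|u - (u + rho)| < xi by rewrite ltr_norml; lra.
  have := Hm _ ur0 urt; have := Hxi (u + rho) u ur0 (ltW urt) u0 uu.
  rewrite ltr_norml; lra.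
rewrite -leNgt => su; have su' : t - 2 * rho <= u.
  by apply: le_trans su; rewrite le_max lexx orbT.
have us' : u < t + 5 * rho.
  apply: (lt_le_trans us); rewrite lerD2r ge_max t0 /=; lra.
have ut : `|u - t| < eta by rewrite ltr_norml; lra.
have := Heta u u0 ut; rewrite ltr_norml /mu; move: r2; rewrite /mu; lra.
Qed.

End paths.

(** Conditionally on [X0], the law of [B t] is Gaussian and has no atoms. *)
Lemma prob_state_eq {R : realType} {d : measure_display} {Om : measurableType d}
    (P : probability Om R) (X0 : Om -> R) (B : R -> Om -> R) (t c : R) :
  mv_data P X0 B -> 0 < t -> P [set w | X0 w + B t w = c] = 0%E.
Proof.
move=> [mX [mB B0 _ lawB _] indX] t0.
have mBt : measurable_fun setT (B t) by apply: mB; exact: ltW.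
have mC : measurable ([set p | p.1 + p.2 = c] : set (R * R)).
  have mf : measurable_fun setT (fun p : R * R => p.1 + p.2).
    by apply: measurable_funD; [exact: measurable_fst|exact: measurable_snd].
  rewrite [X in measurable X](_ : _ = (fun p : R * R => p.1 + p.2) @^-1` [set c]) //.
  by rewrite -[X in measurable X]setTI; exact: mf.
rewrite (@indep_joint_law _ _ _ _ _ _ _ P X0 (B t) mX mBt _ _ mC); last first.
  move=> A1 A2 mA1 mA2; rewrite indX //; apply: sub_sigma_algebra.
  by exists t; split; [rewrite /= in_itv /= andbT ltW|exists A2].
apply: integral0_eq => w _ /=.
have := lawB 0 t (lexx _) t0 [set c - X0 w] (measurable_set1 _).
rewrite normal_prob_set1 => <-; congr (P _).
by apply/seteqP; split => w' /=; rewrite B0 subr0; [move=> <-|move=> ->]; lra.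
Qed.

(** The solution property gives [L 0 = alpha * P (X0 <= L 0)], whereas the physical condition gives
    [L 0 <= alpha * P (0 < X0 <= L 0)]. Nothing is left for [X0 <= 0]. *)
Lemma physical_initial_pos {R : realType} {d : measure_display} {Om : measurableType d}
    (P : probability Om R) (alpha : R) (X0 : Om -> R) (B : R -> Om -> R) (L : R -> R) :
  0 < alpha -> mv_data P X0 B -> mv_solution P alpha X0 B L ->
  physical_jump_at P alpha X0 B L 0 -> prob P [set w | X0 w <= 0] = 0.
Proof.
move=> halpha hdata hsol phys.
have ML : M L by case: hsol.
have [mX [_ B0 cB _ _] _] := hdata.
have mle y : measurable [set w | X0 w <= y].
  rewrite [X in measurable X](_ : _ = X0 @^-1` `]-oo, y]).
    by rewrite -[X in measurable X]setTI; exact: mX.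
  by apply/seteqP; split => w; rewrite /= in_itv.
have mlt y : measurable [set w | 0 < X0 w <= y].
  rewrite [X in measurable X](_ : _ = X0 @^-1` `]0, y]).
    by rewrite -[X in measurable X]setTI; exact: mX.
  by apply/seteqP; split => w; rewrite /= in_itv.
have JE y : [set w | (0%:E <= tau X0 B L w)%E /\ 0 < left_limit (mvX X0 B L w) 0 <= y]
    = [set w | 0 < X0 w <= y].
  have E w : left_limit (mvX X0 B L w) 0 = X0 w.
    by rewrite (left_limit_mvX _ B0 cB ML) // B0 (M_left_limit0 ML) addr0 subr0.
  apply/seteqP; split => w /=; rewrite E; first by case.
  by move=> ?; split => //; apply/le_tauP => u u0; rewrite ltNge u0.
have L0 : L 0 = alpha * prob P [set w | X0 w <= L 0].
  rewrite {1}(solution_gt hdata hsol (lexx 0)) -prob_setC; last first.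
    exact: (measurable_gt_tau hdata hsol).
  congr (_ * prob P _); apply/seteqP; split => w /=.
    move=> H; rewrite leNgt; apply/negP => Lw; apply: H.
    apply/(lt_tauP _ cB ML _ (lexx 0)) => u u0 u0'.
    have -> : u = 0 by apply/eqP; rewrite eq_le u0 u0'.
    by rewrite B0 addr0 subr_gt0.
  move=> Lw /(lt_tauP _ cB ML _ (lexx 0)) /(_ 0 (lexx _) (lexx _)).
  by rewrite B0 addr0 subr_gt0 ltNge Lw.
have Lge0 : 0 <= L 0 := M_ge0 ML 0.
have split0 : prob P [set w | X0 w <= L 0] =
    prob P [set w | X0 w <= 0] + prob P [set w | 0 < X0 w <= L 0].
  rewrite -prob_setU //; first congr (prob P _).
    apply/seteqP; split => w /=.
      by move=> h; case: (ltP 0 (X0 w)) => h'; [right; rewrite h|left].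
    by move=> [h|/andP[]//]; exact: le_trans Lge0.
  by apply/seteqP; split => w //= [h1 /andP[h2 _]]; lra.
move: phys; rewrite /physical_jump_at (M_left_limit0 ML) subr0.
under [X in inf X]eq_set => x do rewrite JE.
move=> L0inf.
have low y : 0 < y -> y < L 0 -> y <= alpha * prob P [set w | 0 < X0 w <= y].
  move=> y0 yL; rewrite leNgt; apply/negP => H.
  have : L 0 <= y.
    rewrite L0inf; apply: ge_inf; first by exists 0 => z [/ltW].
    by split => //; rewrite probE // -EFinM lte_fin.
  by rewrite leNgt yL.
have Lle : L 0 <= alpha * prob P [set w | 0 < X0 w <= L 0].
  apply/ler_addgt0Pr => e e0.
  have a0 : 0 <= alpha * prob P [set w | 0 < X0 w <= L 0].
    by rewrite mulr_ge0 ?prob_ge0 // ltW.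
  have [h|h] := leP (L 0 - e) 0; first by lra.
  have := low (L 0 - e) h ltac:(lra).
  have : prob P [set w | 0 < X0 w <= L 0 - e] <= prob P [set w | 0 < X0 w <= L 0].
    by apply: prob_le => // w /= /andP[-> /= h']; lra.
  by move=> /(ler_wpM2l (ltW halpha)); lra.
have : alpha * prob P [set w | X0 w <= 0] <= 0.
  by move: L0; rewrite split0 mulrDr; lra.
rewrite pmulr_rle0 // => h; apply/eqP; rewrite eq_le h; exact: prob_ge0.
Qed.

(** The test function [f] is bounded, continuous and positive exactly on the negative half-line; its
    means vanish along the sequence, hence in the limit. *)
Lemma cvg_in_law_ge0 {R : realType} {d : measure_display}
  {Om : measurableType d} (P : probability Om R) (X0 : Om -> R)
  (d_ : nat -> measure_display) (Om_ : forall n, measurableType (d_ n))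
  (P_ : forall n, probability (Om_ n) R) (X0_ : forall n, Om_ n -> R) :
  measurable_fun setT X0 -> (forall n, measurable_fun setT (X0_ n)) ->
  cvg_in_law P_ X0_ P X0 -> (forall n, prob (P_ n) [set w | X0_ n w <= 0] = 0) ->
  prob P [set w | X0 w < 0] = 0.
Proof.
move=> mX mX_ hlaw null_.
have mle e (T : measurableType e) (Y : T -> R) y : measurable_fun setT Y ->
    measurable [set w | Y w <= y].
  move=> mY; rewrite [X in measurable X](_ : _ = Y @^-1` `]-oo, y]).
    by rewrite -[X in measurable X]setTI; exact: mY.
  by apply/seteqP; split => w; rewrite /= in_itv.
pose f (x : R) := Num.min 1 (Num.max 0 (- x)).
have f0 x : 0 <= f x by rewrite /f le_min ler01 le_max lexx.
have f1 x : f x <= 1 by rewrite /f ge_min lexx.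
have cf : continuous f.
  move=> x; apply: (@continuous_min R R (cst 1) (cst 0 \max -%R) x); first exact: cvg_cst.
  by apply: (@continuous_max R R (cst 0) -%R x); [exact: cvg_cst|exact: opp_continuous].
have mf : measurable_fun setT f by exact: continuous_measurable_fun.
have fb : exists K : R, forall x, `|f x| <= K.
  by exists 1 => x; rewrite ger0_norm.
have E0 n : ('E_(P_ n)[f \o X0_ n] = 0)%E.
  apply/eqP; rewrite eq_le; apply/andP; split; last first.
    by rewrite unlock; apply: integral_ge0 => w _; rewrite lee_fin; exact: f0.
  have mn := mle _ _ (X0_ n) 0 (mX_ n).
  have <- : P_ n [set w | X0_ n w <= 0] = 0%E by rewrite probE // null_.
  rewrite -[X in (_ <= P_ n X)%E]setIT -integral_indic // unlock.
  apply: ge0_le_integral => //.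
  - by move=> w _; rewrite lee_fin; exact: f0.
  - by apply/measurable_EFinP; exact: measurableT_comp.
  - by apply/measurable_EFinP; exact: measurable_indic.
  - move=> w _; rewrite lee_fin /= indicE; case: (leP (X0_ n w) 0) => h.
      by rewrite mem_set.
    rewrite memNset /=; last by apply/negP; rewrite -ltNge.
    by rewrite /f ge_min; apply/orP; right; rewrite ge_max lexx /=; lra.
have EX : ('E_P[f \o X0] = 0)%E.
  have := hlaw f cf fb; rewrite (_ : (fun n => _) = cst 0%E); last first.
    by apply/funext => n; rewrite E0.
  move=> h; apply/esym; apply: (cvg_unique _ _ h) => //; exact: cvg_cst.
have mX0lt : measurable [set w | X0 w < 0].
  rewrite [X in measurable X](_ : _ = X0 @^-1` `]-oo, 0[).
    by rewrite -[X in measurable X]setTI; exact: mX.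
  by apply/seteqP; split => w; rewrite /= in_itv.
suff : P [set w | X0 w < 0] = 0%E by rewrite /prob => ->.
have : (\int[P]_w `|(f (X0 w))%:E| = 0)%E.
  rewrite -EX unlock; apply: eq_integral => w _ /=; by rewrite ger0_norm.
have mfX : measurable_fun setT (fun w => (f (X0 w))%:E).
  by apply/measurable_EFinP; exact: measurableT_comp.
move=> /(ae_eq_integral_abs P measurableT mfX) [N [mN N0 HN]].
apply/eqP; rewrite eq_le measure_ge0 andbT -N0; apply: le_measure; rewrite ?inE //.
move=> w /= Xw; apply: HN => /= /(_ I) [].
by rewrite /f => h; have : 0 < Num.min 1 (Num.max 0 (- X0 w));
  [rewrite lt_min ltr01 lt_max oppr_gt0 Xw orbT|rewrite h ltxx].
Qed.

Section jump_upper_bound.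
Context {R : realType} {alpha : R} {d : measure_display} {Om : measurableType d}
  {P : probability Om R} {X0 : Om -> R} {B : R -> Om -> R} {L : R -> R}
  {d_ : nat -> measure_display} {Om_ : forall n, measurableType (d_ n)}
  {P_ : forall n, probability (Om_ n) R}
  {X0_ : forall n, Om_ n -> R} {B_ : forall n, R -> Om_ n -> R}
  {L_ : nat -> R -> R}.
Arguments P_ : clear implicits.
Arguments X0_ : clear implicits.
Arguments B_ : clear implicits.
Hypotheses (halpha : 0 < alpha) (hdata : mv_data P X0 B)
  (hsol : mv_solution P alpha X0 B L)
  (hdata_ : forall n, mv_data (P_ n) (X0_ n) (B_ n))
  (hphys_ : forall n, physical_solution (P_ n) alpha (X0_ n) (B_ n) (L_ n))
  (hlaw : cvg_in_law P_ X0_ P X0) (hM1 : m1_cvg L_ L).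

Let ML : M L. Proof. by case: hsol. Qed.
Let ML_ n : M (L_ n). Proof. by case: (hphys_ n) => -[]. Qed.
Let Lmono (s t : R) : s <= t -> L s <= L t.
Proof. by case: ML => _ _; apply. Qed.
Let L_mono n (s t : R) : s <= t -> L_ n s <= L_ n t.
Proof. by case: (ML_ n) => _ _; apply. Qed.
Let mX0 : measurable_fun setT X0. Proof. by case: hdata. Qed.
Let B0 w : B 0 w = 0. Proof. by case: hdata => _ [_ + _ _ _] _; apply. Qed.
Let cB w : {within `[0, +oo[, continuous (fun t => B t w)}.
Proof. by case: hdata => _ [_ _ + _ _] _; apply. Qed.

(** Turns the barrier event into path conditions of the kind required by [physical_increment_lt].
    Before the window, the barrier exceeds the M1 upper bound of [L_ n] by [rho], whence strict
    positivity. *)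
Lemma barrier_separates n (t x rho : R) w : 0 <= t -> 0 < rho ->
  (forall u : R, -1 <= u -> u <= t + 5 * rho -> L_ n u <= L (u + rho) + rho) ->
  dyadic_event (X0_ n) (B_ n) (barrier_domain t rho) (barrier L t x rho) w ->
  (forall u : R, 0 <= u -> u < Num.max 0 (t - 2 * rho) ->
     0 < X0_ n w + B_ n u w - L_ n u) /\
  (forall u : R, Num.max 0 (t - 2 * rho) <= u -> u < Num.max 0 (t - 2 * rho) + 5 * rho ->
     left_limit L t + x + 2 * rho <= X0_ n w + B_ n u w).
Proof.
move=> t0 rho0 LnL Ew; set s := Num.max 0 (t - 2 * rho) in Ew *.
have cBn w' : {within `[0, +oo[, continuous (fun u => B_ n u w')}.
  by case: (hdata_ n) => _ [_ _ + _ _] _; apply.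
have s0 : 0 <= s by rewrite /s le_max lexx.
have st : s <= t by rewrite /s ge_max t0 /=; lra.
split=> u hu us.
  have := @dyadic_event_dense _ _ _ _ cBn _ _ _ u s (L (u + rho) + 2 * rho) Ew hu us _.
  have := LnL u ltac:(lra) ltac:(lra).
  suff h : forall v, u < v -> v < s -> barrier_domain t rho v /\
    L (u + rho) + 2 * rho <= barrier L t x rho v.
    by move=> h1 /(_ h) h2; lra.
  move=> v uv vs; split; first by split; [lra|rewrite -/s; lra].
  by rewrite /barrier -/s vs lerD2r Lmono // lerD2r ltW.
have u0 : 0 <= u by exact: le_trans hu.
apply: (@dyadic_event_dense _ _ _ _ cBn _ _ _ u _ _ Ew u0 us) => v uv vs.
split; first by split => //; lra.
by rewrite /barrier -/s ltNge (le_trans hu (ltW uv)).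
Qed.

Lemma jump_le (t x : R) : 0 <= t -> 0 < x ->
  prob P [set w | (t%:E <= tau X0 B L w)%E /\
     X0 w + B t w - left_limit L t <= 0] = 0 ->
  alpha * prob P [set w | (t%:E <= tau X0 B L w)%E /\
     0 < X0 w + B t w - left_limit L t <= x] < x ->
  L t - left_limit L t <= x.
Proof.
move=> t0 x0 null0 ltx.
have mge := measurable_ge_tau hdata hsol t0.
have mst I : measurable I -> measurable ([set w | (t%:E <= tau X0 B L w)%E] `&`
    [set w | I (X0 w + B t w - left_limit L t)]).
  by move=> mI; apply: measurableI => //; exact: (measurable_state hdata).
set Z := [set w | _ /\ X0 w + B t w - left_limit L t <= 0] in null0.
set J := [set w | _ /\ 0 < X0 w + B t w - left_limit L t <= x] in ltx.
have mZ : measurable Z.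
  rewrite [X in measurable X](_ : _ = [set w | (t%:E <= tau X0 B L w)%E] `&`
    [set w | `]-oo, 0]%classic (X0 w + B t w - left_limit L t)]).
    exact: (mst).
  by apply/seteqP; split => w; rewrite /= in_itv.
have mJ : measurable J.
  rewrite [X in measurable X](_ : _ = [set w | (t%:E <= tau X0 B L w)%E] `&`
    [set w | `]0, x]%classic (X0 w + B t w - left_limit L t)]).
    exact: (mst).
  by apply/seteqP; split => w; rewrite /= in_itv.
pose A := [set w | (t%:E <= tau X0 B L w)%E /\ x < X0 w + B t w - left_limit L t].
have mA : measurable A.
  rewrite [X in measurable X](_ : _ = [set w | (t%:E <= tau X0 B L w)%E] `&`
    [set w | `]x, +oo[%classic (X0 w + B t w - left_limit L t)]).
    exact: (mst).
  by apply/seteqP; split => w; rewrite /= in_itv /= andbT.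
pose kappa := x - alpha * prob P J.
have kappa0 : 0 < kappa by rewrite /kappa; lra.
have ll := solution_ge halpha hdata hsol t0.
(* Up to the null set [Z], the unabsorbed paths before [t] lie in [A] or in [J], and [J] has
   [alpha]-mass [x - kappa]. *)
have Abig : alpha - left_limit L t - x + kappa <= alpha * prob P A.
  have : prob P [set w | (t%:E <= tau X0 B L w)%E] <= prob P (A `|` (J `|` Z)).
    apply: prob_le => //; first by do ?apply: measurableU.
    move=> w tw; have [h|h] := ltP x (X0 w + B t w - left_limit L t); first by left.
    by right; have [h'|h'] := ltP 0 (X0 w + B t w - left_limit L t); [left; split => //; rewrite h'|right].
  have mJZ : measurable (J `|` Z) by exact: measurableU.
  have := prob_setU_le P mA mJZ; have := prob_setU_le P mJ mZ; rewrite null0.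
  move=> h1 h2 h3; have := le_trans h3 h2; have := h1 => {}h1 {}h2.
  have : prob P [set w | (t%:E <= tau X0 B L w)%E] <= prob P A + prob P J by lra.
  by move=> /(ler_wpM2l (ltW halpha)); rewrite /kappa; lra.
apply/ler_addgt0Pr => e e0.
(* An error [ep] is incurred twice, in passing from [A] to [E k] and from [P] to [P_ n]; together
   they cost [kappa / 4]. *)
pose ep := kappa / (8 * alpha).
have ep0 : 0 < ep by rewrite /ep divr_gt0 // mulr_gt0.
have aep : alpha * ep = kappa / 8.
  by rewrite /ep invfM mulrCA !mulrA mulrAC mulfK ?gt_eqF.
have k40 : 0 < kappa / 8 by lra.
have [v vt Lv] := left_limit_near ML t k40.
pose E k := dyadic_event X0 B (barrier_domain t k.+1%:R^-1)
    (fun u => barrier L t x k.+1%:R^-1 u + k.+1%:R^-1).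
have dom0 rho u : barrier_domain t rho u -> 0 <= u by case.
have mE k : measurable (E k).
  by apply: (measurable_mv_dyadic_event hdata) => u; exact: dom0.
have AE w : A w -> \forall k \near \oo, E k w.
  by move=> [tw Xw]; exact: (above_barrier cB ML).
have [k1 _ Hk1] := prob_liminf P mE mA AE ep0.
(* For [rho = k.+1%:R^-1]: the final loss [2 * rho] is below [e], the time [t - 3 * rho] stays above
   -1, [t - 5 * rho] lies after [v], and a loss of [rho] costs at most [kappa / 8]. *)
have [k2 Hk2] : exists k2 : nat, forall k, (k2 <= k)%N ->
    k.+1%:R^-1 < Num.min (Num.min (e / 2) (1 / 3)) (Num.min ((t - v) / 5) (kappa / 8)).
  apply: natSinv_lt; rewrite !lt_min k40 andbT; do ?[apply/andP; split]; lra.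
pose k := maxn k1 k2.
have := Hk1 k (leq_maxl _ _); have := Hk2 k (leq_maxr _ _).
have rho0 : 0 < k.+1%:R^-1 :> R by rewrite invr_gt0.
rewrite /E; move: (k.+1%:R^-1) rho0 => rho rho0.
rewrite !lt_min => /andP[/andP[r1 r2] /andP[r3 r4]] PE.
set s := Num.max 0 (t - 2 * rho).
have s0 : 0 <= s by rewrite /s le_max lexx.
have ts : t - 2 * rho <= s by rewrite /s le_max lexx orbT.
have [N1 HN1] := dyadic_event_liminf hdata hdata_ hlaw (barrier L t x rho) (@dom0 rho) rho0 ep0.
have [N2 HN2] := m1_cvg_bounds ML_ ML hM1 (t + 5 * rho) rho0.
pose n := maxn N1 N2.
have PEn := HN1 n (leq_maxl _ _); have Ln := HN2 n (leq_maxr _ _).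
have [hsoln physn] := hphys_ n.
have lln : left_limit (L_ n) s <= left_limit L t + rho.
  have [tr|tr] := leP (t - 2 * rho) 0.
    rewrite /s (max_idPl tr) (M_left_limit0 (ML_ n)) addr_ge0 ?(ltW rho0) //.
    by apply: le_trans (left_limit_ge ML (_ : t - 1 < t)); [exact: (M_ge0 ML)|lra].
  rewrite /s (max_idPr (ltW tr)); apply: (le_trans (left_limit_le_self (ML_ n) _)).
  have [_ h] := Ln (t - 2 * rho) ltac:(lra) ltac:(lra).
  have : L (t - 2 * rho + rho) <= left_limit L t by apply: left_limit_ge => //; lra.
  lra.
have lln' : left_limit L t - kappa / 4 <= left_limit (L_ n) s.
  have h1 : L_ n (t - 3 * rho) <= left_limit (L_ n) s by apply: left_limit_ge => //; lra.
  have [h2 _] := Ln (t - 3 * rho) ltac:(lra) ltac:(lra).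
  have : L v <= L (t - 3 * rho - 2 * rho) by apply: Lmono; lra.
  lra.
have sep w := @barrier_separates n t x rho w t0 rho0 (fun u h1 h2 => proj2 (Ln u h1 h2)).
have mEn : measurable (dyadic_event (X0_ n) (B_ n) (barrier_domain t rho) (barrier L t x rho)).
  by apply: (measurable_mv_dyadic_event (hdata_ n)) => u; exact: dom0.
have incr := @physical_increment_lt _ _ _ _ _ _ _ _ halpha (hdata_ n) hsoln
  s (5 * rho) x _ physn s0 x0 mEn.
have := incr _ _ _ (t + 2 * rho) ltac:(rewrite /s ge_max; apply/andP; split; lra) ltac:(lra).
have st : s <= t by rewrite /s ge_max t0 /=; lra.
have h3 : L t <= L_ n (t + 2 * rho) + rho.
  have [h _] := Ln (t + 2 * rho) ltac:(lra) ltac:(lra).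
  have : L t <= L (t + 2 * rho - 2 * rho) by apply: Lmono; lra.
  lra.
(* Then [L t] is less than the left limit of [L] at [t] plus [x + 2 * rho]: one [rho] comes from
   [h3], the other from [lln]. *)
suff : L_ n (t + 2 * rho) - left_limit (L_ n) s < x by lra.
apply: incr.
- by move=> w /sep[h _] u; exact: h.
- move=> w /sep[_ h] u su us; have := h u su us; lra.
- have : alpha * prob P A - 2 * (alpha * ep) <
    alpha * prob (P_ n) (dyadic_event (X0_ n) (B_ n) (barrier_domain t rho) (barrier L t x rho)).
    by rewrite mulrCA -mulrBr ltr_pM2l //; lra.
  rewrite aep; lra.
- lra.
- lra.
Qed.

End jump_upper_bound.

(** * The jump condition for the limit *)

Unset Implicit Arguments.

(** Both bounds combine once no unabsorbed mass lies at or below 0 just before [t]. For [t > 0] this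
    follows from the Gaussian law of [B t]. At 0 it amounts to [X0 > 0] almost surely; a weak limit
    of laws on the positive half-line is carried by [[0, +oo[] but may have an atom at 0, in which
    case the condition fails there. *)
Theorem theorem1p2 (R : realType) (alpha : R) (halpha : 0 < alpha)
  (d : measure_display) (Om : measurableType d) (P : probability Om R)
  (X0 : Om -> R) (B : R -> Om -> R) (L : R -> R)
  (hdata : mv_data P X0 B) (hmean : finite_mean P X0)
  (hsol : mv_solution P alpha X0 B L)
  (d_ : nat -> measure_display) (Om_ : forall n, measurableType (d_ n))
  (P_ : forall n, probability (Om_ n) R)
  (X0_ : forall n, Om_ n -> R) (B_ : forall n, R -> Om_ n -> R)
  (L_ : nat -> R -> R)
  (hdata_ : forall n, mv_data (P_ n) (X0_ n) (B_ n))
  (hmean_ : forall n, finite_mean (P_ n) (X0_ n))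
  (hphys_ : forall n, physical_solution (P_ n) alpha (X0_ n) (B_ n) (L_ n))
  (hlaw : cvg_in_law P_ X0_ P X0)
  (hM1 : m1_cvg L_ L) :
  (forall t, 0 < t -> physical_jump_at P alpha X0 B L t) /\
  (P [set w | X0 w = 0] = 0%E -> physical_jump_at P alpha X0 B L 0).
Proof.
have ML : M L by case: hsol.
have [mX [_ B0 cB _ _] _] := hdata.
have jump t : 0 <= t ->
    prob P [set w | (t%:E <= tau X0 B L w)%E /\ X0 w + B t w - left_limit L t <= 0] = 0 ->
    physical_jump_at P alpha X0 B L t.
  move=> t0 null0; apply/eqP; rewrite eq_le; apply/andP; split; last first.
    exact: (jump_ge_inf halpha hdata hsol t0).
  apply: lb_le_inf.
    (* A probability is at most 1, so [alpha + 1] lies in the set, which makes the infimum a genuine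
       one. *)
    exists (alpha + 1); split; first lra.
    rewrite probE; last exact: (measurable_jump_event hdata hsol).
    rewrite -EFinM lte_fin.
    have := prob_le1 P (measurable_jump_event hdata hsol (alpha + 1) t0).
    by move=> /(ler_wpM2l (ltW halpha)); lra.
  move=> x [x0]; rewrite probE; last exact: (measurable_jump_event hdata hsol).
  rewrite -EFinM lte_fin => ltx.
  apply: (jump_le halpha hdata hsol hdata_ hphys_ hlaw hM1 t0 x0 null0).
  move: ltx; under eq_set do rewrite (left_limit_mvX _ B0 cB ML) //.
  by [].
split=> [t t0|X00]; apply: jump => //; first exact: ltW.
- have mZ : measurable [set w | X0 w + B t w - left_limit L t = 0].
    exact: (@measurable_state _ _ _ _ _ _ hdata (left_limit L t) t [set 0] (ltW t0) (measurable_set1 0)).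
  apply/eqP; rewrite eq_le prob_ge0 andbT.
  have z : prob P [set w | X0 w + B t w - left_limit L t = 0] = 0.
    rewrite /prob (_ : mkset _ = [set w | X0 w + B t w = left_limit L t]).
      by rewrite (prob_state_eq _ hdata t0).
    by apply/seteqP; split => w /=; lra.
  rewrite -[leRHS]z; apply: prob_le => //.
    apply: measurableI; first exact: (measurable_ge_tau hdata hsol (ltW t0)).
    rewrite [X in measurable X](_ : _ = [set w | `]-oo, 0]%classic (X0 w + B t w - left_limit L t)]).
      by apply: (@measurable_state _ _ _ _ _ _ hdata (left_limit L t) t `]-oo, 0]%classic); [exact: ltW|].
    by apply/seteqP; split => w; rewrite /= in_itv.
  (* An unabsorbed path has a non-negative left state, so a state at most 0 is exactly 0, which is a
     null event. *)
  move=> w /= [tw Xw]; apply/eqP; rewrite eq_le Xw /=.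
  exact: (left_state_ge0 cB ML t0 tw).
- have mX_ n : measurable_fun setT (X0_ n) by case: (hdata_ n).
  have neg0 : prob P [set w | X0 w < 0] = 0.
    apply: (cvg_in_law_ge0 mX mX_ hlaw) => n; have [hsoln physn] := hphys_ n.
    exact: (physical_initial_pos halpha (hdata_ n) hsoln (physn 0 (lexx 0))).
  have mlt : measurable [set w | X0 w < 0].
    rewrite [X in measurable X](_ : _ = X0 @^-1` `]-oo, 0[).
      by rewrite -[X in measurable X]setTI; exact: mX.
    by apply/seteqP; split => w; rewrite /= in_itv.
  have meq : measurable [set w | X0 w = 0].
    by rewrite -[X in measurable X]setTI; exact: (mX measurableT _ (measurable_set1 0)).
  apply/eqP; rewrite eq_le prob_ge0 andbT.
  have z : prob P [set w | X0 w < 0] + prob P [set w | X0 w = 0] = 0.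
    by rewrite neg0 /prob X00 addr0.
  rewrite -[leRHS]z; apply: le_trans (prob_setU_le _ mlt meq); apply: prob_le => //.
  + apply: measurableI; first exact: (measurable_ge_tau hdata hsol (lexx 0)).
    rewrite [X in measurable X](_ : _ = [set w | `]-oo, 0]%classic (X0 w + B 0 w - left_limit L 0)]).
      exact: (@measurable_state _ _ _ _ _ _ hdata (left_limit L 0) 0 `]-oo, 0]%classic).
    by apply/seteqP; split => w; rewrite /= in_itv.
  + exact: measurableU.
  + move=> w /= [_]; rewrite B0 (M_left_limit0 ML) addr0 subr0 le_eqVlt.
    by move=> /predU1P[|]; [right|left].
Qed.
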